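(* Let $\Omega\subseteq\mathbf P^6$ be the Zariski closure of the set of tri-involutive sextuples. Then the degree of the projective variety $\Omega$ is $16$.
   Context: The base field is $\mathbf C$. A set of six points $\{z_1,\dots,z_6\}\subseteq\mathbf C\cup\{\infty\}=\mathbf P^1$ is identified with a point of $\mathrm{Sym}^6\,\mathbf P^1\simeq\mathbf P^6$, the projective space of binary sextic forms, via the form $\prod_{i=1}^6(x_1-z_ix_2)$ (a factor with $z_i=\infty$ is interpreted as $x_2$). A set of six distinct points of $\mathbf P^1$ is a tri-involutive sextuple if it is projectively equivalent (under an automorphism of $\mathbf P^1$) to $\{0,1,\infty,p,\frac{p-1}{p},\frac{1}{1-p}\}$ for some $p\in\mathbf P^1$. $\Omega$ is a four-dimensional irreducible projective subvariety of $\mathbf P^6$. *)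

(* Defs.v *)
From HB Require Import structures.
From mathcomp Require Import all_boot all_order all_algebra.
From mathcomp Require Import finmap mpoly.

Set Implicit Arguments.
Unset Strict Implicit.
Unset Printing Implicit Defensive.

Import GRing.Theory.
Local Open Scope ring_scope.

(* Subsets of P^n are predicates on homogeneous coordinate vectors; only their
   values at nonzero vectors are meaningful. *)
Section ProjectiveSets.
Variables (F : fieldType) (n : nat).
Implicit Types (X Z : 'rV[F]_n.+1 -> Prop) (v : 'rV[F]_n.+1).

Definition vanishes_at (f : {mpoly F[n.+1]}) v : Prop :=
  f.@[fun i => v 0 i] = 0.

Definition vanishes_on X (f : {mpoly F[n.+1]}) : Prop :=
  forall v, v != 0 -> X v -> vanishes_at f v.

Definition zariski_closed Z : Prop :=
  exists E : {mpoly F[n.+1]} -> Prop,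
    (forall f, E f -> exists d, f \is d.-homog) /\
    (forall v, v != 0 -> (Z v <-> forall f, E f -> vanishes_at f v)).

Definition zariski_closure X v : Prop :=
  v != 0 /\
  forall Z, zariski_closed Z -> (forall u, u != 0 -> X u -> Z u) -> Z v.

(* [h] is the dimension of the degree [d] part of the homogeneous coordinate
   ring S / I(X), where S is the polynomial ring in n + 1 variables; the
   subspace [V] is the degree [d] part of I(X). *)
Definition hilbert_function X (d h : nat) : Prop :=
  exists V : {vspace dhomog n.+1 F d},
    (forall f : dhomog n.+1 F d, f \in V <-> vanishes_on X f) /\
    (\dim (fullv : {vspace dhomog n.+1 F d}) = \dim V + h)%N.

Definition hilbert_polynomial X (P : {poly rat}) : Prop :=
  exists d0 : nat, forall d : nat, (d0 <= d)%N ->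
    exists h : nat, hilbert_function X d h /\ P.[d%:R] = h%:R.

(* The degree of X is r! times the leading coefficient of its Hilbert
   polynomial, whose degree r is the dimension of X. *)
Definition has_degree X (e : nat) : Prop :=
  exists P : {poly rat}, hilbert_polynomial X P /\
    ((size P).-1)`!%:R * lead_coef P = e%:R.

End ProjectiveSets.

Section Sextuples.
Variable F : fieldType.

(* P^1 as F together with a point at infinity, [None]. *)
Definition P1 : choiceType := option F.

Definition infty : P1 := None.
Definition affine (x : F) : P1 := Some x.

(* z |-> (a z + b) / (c z + d) *)
Definition mobius (a b c d : F) (z : P1) : P1 :=
  match z with
  | Some x => if c * x + d == 0 then infty
              else affine ((a * x + b) / (c * x + d))
  | None => if c == 0 then infty else affine (a / c)
  end.

Definition projectively_equivalent (A B : {fset P1}) : Prop :=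
  exists a b c d : F,
    a * d - b * c != 0 /\ [fset mobius a b c d z | z in A]%fset = B.

(* {0, 1, oo, p, (p - 1) / p, 1 / (1 - p)} for any p in P^1 *)
Definition standard_sextuple (p : P1) : {fset P1} :=
  [fset affine 0; affine 1; infty; p;
        mobius 1 (-1) 1 0 p; mobius 0 1 (-1) 1 p]%fset.

Definition tri_involutive (A : {fset P1}) : Prop :=
  #|` A| = 6%N /\ exists p : P1, projectively_equivalent A (standard_sextuple p).

Definition linear_factor (z : P1) : {mpoly F[2]} :=
  match z with
  | Some x => 'X_0 - x *: 'X_1
  | None => 'X_1
  end.

Definition form_of (A : {fset P1}) : {mpoly F[2]} :=
  \prod_(z <- A) linear_factor z.

(* Coordinates on P^6 = P(binary sextic forms): the coefficients of
   x1^(6 - i) x2^i for 0 <= i <= 6. *)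
Definition sextic_coords (f : {mpoly F[2]}) : 'rV[F]_7 :=
  \row_(i < 7) f@_(U_(0%R) *+ (6 - i) + U_(1%R) *+ i)%MM.

Definition tri_involutive_locus (v : 'rV[F]_7) : Prop :=
  exists A : {fset P1}, tri_involutive A /\
    exists c : F, c != 0 /\ v = c *: sextic_coords (form_of A).

Definition Omega : 'rV[F]_7 -> Prop := zariski_closure tri_involutive_locus.

End Sextuples.

(* Main.v *)
Require Import Defs.
From mathcomp Require Import all_boot all_order all_algebra.
From mathcomp Require Import finmap mpoly complex reals.
From mathcomp Require Import boolp archimedean.
From mathcomp Require Import ring lra zify.

(** A sextuple {0, 1, oo, p, (p-1)/p, 1/(1-p)} is the union of two orbits of an
    automorphism of order 3 of P^1.  If u v is the quadratic form of its two
    fixed points, the orbits are the zero sets of cubics of the pencil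
    <u^3, v^3>, so the tri-involutive sextics are, up to closure, the forms
    a u^6 + b u^3 v^3 + c v^6: products f g of two cubics of one pencil
    <u^3, v^3>.  They depend on 4 projective parameters, and the claim is that
    the Hilbert function h(d) of the locus grows like (16 / 4!) d^4.

    That h is eventually a polynomial is Hilbert's theorem, proved here for any
    subset of P^n: h(d) counts the monomials of degree d that are not leading
    monomials of the vanishing ideal; these are the points outside an up-set of
    N^(n+1), Dickson's lemma makes the up-set finitely generated, and slicing
    it along one coordinate gives the claim by induction
    ([hilbert_polynomial_exists]).  Hence the leading term of h only has to be
    squeezed between two bounds ([degree16_of_bounds]).

    Upper bound.  A pair (f, g) in the pencil <u^3, v^3> satisfies four
    equations: each of f, g is apolar to the Hessian of the other.  Two have
    bidegree (2, 1) and two have bidegree (1, 2).  For a suitable weight their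
    leading monomials are f2^2 g0, f1^2 g3, f1 g0 g3, f2 g0 g3, and the
    monomials of bidegree (d, d) divisible by none of them number
    (4/3) d^4 + O(d^3).  A form M of degree d in the coefficients of a sextic
    gives the bihomogeneous function M(fg), symmetric in f and g; multiplied by
    an alternating function of bidegree (1, 1), a form of degree d - 1 gives an
    antisymmetric one.  Symmetric and antisymmetric functions are independent,
    so h(d) + h(d-1) <= (4/3) d^4 + O(d^3)
    ([hilbert_function_consecutive_le]).

    Lower bound.  If a linear section of complementary dimension contains N
    distinct points of the closure at which it is transversal, then
    h(d) >= N d^4 / 4! + O(d^3) ([hilbert_function_ge_section]).  A section
    with N = 16 is the plane of sextics
      A (x^6 + 3 x y^5) + B (y^6 - 3 x^5 y) + C x^3 y^3,
    a 3-dimensional representation of the icosahedral group.  Its sixteen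
    points are the 6 cubes of the quadratic forms vanishing at two opposite
    vertices of the icosahedron and 10 sextics attached to its ten axes of order
    3.  One of the cubes is x^3 y^3; the other fifteen points are obtained by
    letting y -> z y, z^5 = 1, act on
      x^6 + 3 x^5 y + (5/q) x^3 y^3 + 3 x y^5 - y^6,
      q^3 - 2 q^2 - 2 q + 1 = 0,
    where q = -1 gives the cubes. *)

Set Implicit Arguments.
Unset Strict Implicit.
Unset Printing Implicit Defensive.

Import Order.TTheory GRing.Theory Num.Theory.

Local Open Scope ring_scope.

(** * Functions that are eventually polynomial *)

Definition eventually_poly (h : nat -> nat) : Prop :=
  exists (P : {poly rat}) (d0 : nat),
    forall d, (d0 <= d)%N -> P.[d%:R] = (h d)%:R.

Lemma eventually_poly_eq (h h' : nat -> nat) (d0 : nat) :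
  (forall d, (d0 <= d)%N -> h d = h' d) ->
  eventually_poly h -> eventually_poly h'.
Proof.
move=> eqh [P [d1 PE]]; exists P, (maxn d0 d1) => d.
by rewrite geq_max => /andP[d0d d1d]; rewrite PE // eqh.
Qed.

Lemma eventually_poly0 : eventually_poly (fun=> 0%N).
Proof. by exists 0, 0%N => d _; rewrite horner0. Qed.

Lemma eventually_polyD (h h' : nat -> nat) :
  eventually_poly h -> eventually_poly h' ->
  eventually_poly (fun d => h d + h' d)%N.
Proof.
move=> [P [d0 PE]] [Q [d1 QE]]; exists (P + Q), (maxn d0 d1) => d.
by rewrite geq_max => /andP[d0d d1d]; rewrite hornerD PE // QE // natrD.
Qed.

Lemma eventually_poly_sum (h : nat -> nat -> nat) (K : nat) :
  (forall k, eventually_poly (h k)) ->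
  eventually_poly (fun d => \sum_(k < K) h k d)%N.
Proof.
move=> hP; elim: K => [|K IH].
  apply: (eventually_poly_eq (d0 := 0%N)) eventually_poly0.
  by move=> d _; rewrite big_ord0.
apply: (eventually_poly_eq (d0 := 0%N)) (eventually_polyD IH (hP K)).
by move=> d _; rewrite big_ord_recr.
Qed.

Lemma eventually_poly_shift (h : nat -> nat) (k : nat) :
  eventually_poly h -> eventually_poly (fun d => h (d - k)%N).
Proof.
move=> [P [d0 PE]]; exists (P \Po ('X - k%:R%:P)), (d0 + k)%N => d led.
by rewrite horner_comp !hornerE -natrB ?PE //; lia.
Qed.

(** The difference of [X^(n+1)] has degree [n] and leading coefficient [n + 1], so
    primitives are built from the top coefficient downwards. *)
Lemma discrete_primitive (P : {poly rat}) :
  exists S : {poly rat}, S \Po ('X + 1%:P) - S = P.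
Proof.
move: {2}(size P) (leqnn (size P)) => n.
elim: n P => [|n IH] P szP.
  exists 0; move: szP; rewrite leqn0 size_poly_eq0 => /eqP->.
  by rewrite comp_poly0 subr0.
pose T : {poly rat} := ('X + 1%:P) ^+ n.+1 - 'X^(n.+1).
have TE i : T`_i = if (i < n.+1)%N then 'C(n.+1, i)%:R else 0.
  rewrite coefB coefXn (addrC 'X) exprDn coef_sum /=.
  under eq_bigr => j _ do rewrite -rmorphXn /= expr1n mul1r coefMn coefXn.
  case: (ltnP i n.+2) => Hi; last first.
    rewrite big1 ?add0r.
      by have [-> ->] : (i == n.+1 = false) /\ (i < n.+1)%N = false;
        [split; lia | rewrite oppr0].
    move=> [j Hj] _ /=; have -> : (i == j) = false by lia.
    by rewrite mul0rn.
  rewrite (bigD1 (Ordinal Hi)) //= eqxx big1 ?addr0; last first.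
    move=> j; rewrite -val_eqE /= eq_sym => /negbTE->; by rewrite mul0rn.
  case: ltnP => Hi2; first by rewrite (_ : (i == n.+1) = false) ?subr0 //; lia.
  have -> : i = n.+1 by lia.
  by rewrite eqxx binn subrr.
have [|S' S'E] := IH (P - (P`_n / n.+1%:R) *: T).
  apply/leq_sizeP => j lenj; rewrite coefB coefZ TE.
  case: ltnP => [ltj|lej].
    have -> : j = n by lia.
    by rewrite binSn divfK ?subrr // pnatr_eq0.
  rewrite mulr0 subr0; apply/(leq_sizeP _ _ szP); lia.
exists ((P`_n / n.+1%:R) *: 'X^(n.+1) + S').
rewrite comp_polyD comp_polyZ comp_Xn_poly opprD addrACA S'E -scalerBr -/T.
by rewrite addrC subrK.
Qed.

(** Partial sums are handled by a discrete primitive of the eventual polynomial;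
    the constant of integration absorbs the irregular initial values. *)
Lemma eventually_poly_partial_sums (h : nat -> nat) :
  eventually_poly h -> eventually_poly (fun d => \sum_(j < d.+1) h j)%N.
Proof.
move=> [P [d0 PE]]; have [S SE] := discrete_primitive P.
exists (S \Po ('X + 1%:P) + ((\sum_(j < d0) h j)%N%:R - S.[d0%:R])%:P), d0.
move=> d led; rewrite !hornerE horner_comp !hornerE.
elim: d led => [|d IH] led.
  have d00 : d0 = 0%N by lia.
  rewrite big_ord1 -(PE 0%N) ?d00 // big_ord0 -SE !hornerE horner_comp !hornerE.
  by rewrite -[0%N%:R]/(0 : rat) /= addr0.
have [ltd|] := ltnP d d0.
  have <- : d0 = d.+1 by lia.
  rewrite big_ord_recr natrD /= -(PE d0) ?leqnn // -SE !hornerE horner_comp.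
  by rewrite !hornerE /=; ring.
move=> /IH IHd; rewrite big_ord_recr natrD /= -IHd.
rewrite -(PE d.+1) // -SE !hornerE horner_comp !hornerE.
by rewrite -[d.+1]addn1 natrD /=; ring.
Qed.

(** * Dickson's lemma and the complement of an up-set *)

(** Exponent vectors of length [n] and total degree [d]; sequences make the
    induction on the number of variables structural. *)
Fixpoint compositions (n d : nat) : seq (seq nat) :=
  if n is n'.+1 then
    flatten [seq [seq k :: s | s <- compositions n' (d - k)] | k <- iota 0 d.+1]
  else if d is 0 then [:: [::]] else [::].

Lemma compositionsS n d : compositions n.+1 d =
  flatten [seq [seq k :: s | s <- compositions n (d - k)] | k <- iota 0 d.+1].
Proof. by []. Qed.

Lemma mem_compositions n d s :
  (s \in compositions n d) = (size s == n) && (sumn s == d).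
Proof.
elim: n d s => [|n IH] d s.
  by case: d s => [|d] [|x s] //=; rewrite ?inE.
rewrite compositionsS; apply/flatten_mapP/idP => [[k]|].
  rewrite mem_iota => /andP[_ ltk] /mapP[t]; rewrite IH => /andP[/eqP st /eqP sd] ->.
  by rewrite /= st sd eqxx /=; apply/eqP; lia.
case: s => [|k s] // /andP[/eqP[ss] /eqP sd].
have {}sd : (k + sumn s)%N = d by [].
exists k; first by rewrite mem_iota; lia.
by apply: map_f; rewrite IH ss eqxx /=; apply/eqP; lia.
Qed.

Lemma uniq_compositions n d : uniq (compositions n d).
Proof.
elim: n d => [|n IH] d; first by case: d.
rewrite compositionsS; have := iota_uniq 0 d.+1.
move: (iota 0 d.+1) => ks; elim: ks => //= k ks IHk /andP[kN /IHk uks].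
rewrite cat_uniq map_inj_uniq ?IH ?uks => [|s t []//].
rewrite andbT /=; apply/hasPn => s /flatten_mapP[k' k'ks /mapP[t _ ->]].
by apply/mapP => -[t' _ [kk' _]]; rewrite -kk' k'ks in kN.
Qed.

(** For the up-set of leading exponents of an ideal this is a Hilbert function. *)
Definition count_outside n (U : pred (seq nat)) d : nat :=
  count (predC U) (compositions n d).

Lemma count_outsideS n U d :
  count_outside n.+1 U d =
  (\sum_(k < d.+1) count_outside n (fun s => U ((k : nat) :: s)) (d - k))%N.
Proof.
rewrite /count_outside compositionsS count_flatten -map_comp sumnE big_map.
rewrite -(big_mkord xpredT (fun k => count (predC (fun s => U (k :: s)))
                                      (compositions n (d - k)))).
by rewrite /index_iota subn0; apply: eq_bigr => k _; rewrite /= count_map.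
Qed.

Lemma eq_count_outside n (U U' : pred (seq nat)) d :
  (forall s, size s = n -> U s = U' s) ->
  count_outside n U d = count_outside n U' d.
Proof.
move=> eqU; apply: eq_in_count => s; rewrite mem_compositions => /andP[/eqP ss _].
by rewrite /= eqU.
Qed.

Definition pointwise_le (s t : seq nat) : bool := all2 leq s t.

Definition up_closed n (U : pred (seq nat)) : Prop :=
  forall s t, size s = n -> pointwise_le s t -> U s -> U t.

Lemma pointwise_le_refl s : pointwise_le s s.
Proof. by elim: s => //= x s ->; rewrite leqnn. Qed.

(** Dickson's lemma.  The slices of the up-set at first coordinate [k] increase
    with [k]; their union is finitely generated by induction, hence is reached
    at some [K].  Generators of the slices up to [K] then suffice. *)
Lemma dickson n (U : pred (seq nat)) : up_closed n U ->
  exists gens : seq (seq nat),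
    (forall g, g \in gens -> size g = n /\ U g) /\
    (forall s, size s = n -> U s -> exists2 g, g \in gens & pointwise_le g s).
Proof.
elim: n U => [|n IH] U upU.
  exists (if U [::] then [:: [::]] else [::]); split=> [g|[|//] _ Us].
    by case: ifP => // U0; rewrite inE => /eqP->.
  by exists [::]; rewrite ?Us ?inE.
pose slice k := [pred s | U (k :: s)].
have up_slice k : up_closed n (slice k).
  by move=> s t ss st; apply: upU; rewrite /= ?ss // leqnn.
have slice_mono k l s : size s = n -> (k <= l)%N -> slice k s -> slice l s.
  by move=> ss kl; apply: upU; rewrite /= ?ss ?kl // pointwise_le_refl.
pose total := [pred s | `[< exists k, slice k s >]].
have up_total : up_closed n total.
  move=> s t ss st /asboolP[k sk]; apply/asboolP; exists k.
  exact: up_slice st sk.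
have [tgens [tgensU tgensP]] := IH _ up_total.
have [K KP] : exists K, forall g, g \in tgens -> slice K g.
  elim: (tgens) tgensU => [|g gs IHg] gU; first by exists 0%N.
  have [|K KP] := IHg; first by move=> h hgs; apply: gU; rewrite inE hgs orbT.
  have [sg /asboolP[k kg]] := gU g (mem_head _ _).
  exists (maxn k K) => h; rewrite inE => /orP[/eqP->|hgs].
    exact: slice_mono sg (leq_maxl _ _) kg.
  apply: slice_mono (KP h hgs); last exact: leq_maxr.
  by have [] := gU h; rewrite // inE hgs orbT.
have [sgens sgensP] := choice (fun k => IH _ (up_slice k)).
exists (flatten [seq [seq k :: g | g <- sgens k] | k <- iota 0 K.+1]); split.
  move=> g /flatten_mapP[k _ /mapP[h hk ->]].
  by have [/(_ h hk)[sh Uh] _] := sgensP k; rewrite /= sh.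
move=> [|l s] // [ss] Us.
have sK : slice (minn l K) s.
  rewrite /minn; case: ltnP => // _.
  have [|g gt gs] := tgensP s ss; first by apply/asboolP; exists l.
  have [sg _] := tgensU g gt.
  by apply: up_slice gs _ => //; apply: KP.
have [_ /(_ s ss sK)[g gk gs]] := sgensP (minn l K).
exists (minn l K :: g); last by rewrite /= geq_minl.
apply/flatten_mapP; exists (minn l K); first by rewrite mem_iota; lia.
exact: map_f.
Qed.

(** Beyond the first coordinates of the generators all slices coincide, so the
    count is a finite sum of shifted counts in one variable less, plus a partial
    sum of such a count. *)
Lemma count_outside_eventually_poly n (U : pred (seq nat)) :
  up_closed n U -> eventually_poly (count_outside n U).
Proof.
elim: n U => [|n IH] U upU.
  apply: (eventually_poly_eq (d0 := 1%N)) eventually_poly0.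
  by case=> // d _.
pose slice k := [pred s | U (k :: s)].
have up_slice k : up_closed n (slice k).
  by move=> s t ss st; apply: upU; rewrite /= ?ss // leqnn.
have [gens [gensU gensP]] := dickson upU.
pose K := \max_(g <- gens) head 0%N g.
have sliceK k s : (K <= k)%N -> size s = n -> slice k s = slice K s.
  move=> Kk ss; apply/idP/idP => /= Us; last first.
    by apply: upU Us; rewrite /= ?ss // Kk pointwise_le_refl.
  have [|[|l g] gg gs] := gensP (k :: s) _ Us; rewrite /= ?ss //.
  have [sg Ug] := gensU _ gg; move: gs => /= /andP[_ gs].
  apply: upU Ug => //=; rewrite gs andbT.
  exact: (@leq_bigmax_seq _ gens xpredT (head 0%N) _ gg).
pose h d := (\sum_(k < K) count_outside n (slice k) (d - k) +
            \sum_(j < (d - K).+1) count_outside n (slice K) j)%N.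
apply: (eventually_poly_eq (h := h) (d0 := K)) => [d Kd|].
  rewrite count_outsideS /h.
  rewrite -(big_mkord xpredT (fun k => count_outside n (slice k) (d - k))).
  rewrite -(big_mkord xpredT (fun k => count_outside n (slice K) k)).
  rewrite -(big_mkord xpredT (fun k => count_outside n (slice k) (d - k))).
  rewrite (@big_cat_nat _ _ _ K 0 d.+1) //=; last by lia.
  congr addn; rewrite -{3}[K]add0n big_addn subSn // [LHS]big_nat_rev /=.
  rewrite [RHS]big_nat [LHS]big_nat; apply: eq_bigr => k Hk.
  rewrite add0n -(eq_count_outside _ (U := slice (k + K)%N)).
    by congr (count_outside n _ _); lia.
  by move=> s ss; apply: sliceK => //; lia.
apply: eventually_polyD.
  apply: (eventually_poly_sum (h := fun k d => count_outside n (slice k) (d - k))) => k.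
  exact/eventually_poly_shift/IH.
apply: (eventually_poly_shift (h := fun e => \sum_(j < e.+1) count_outside n (slice K) j)%N).
exact/eventually_poly_partial_sums/IH.
Qed.

(** The hockey-stick identity. *)
Lemma size_compositions n d : size (compositions n.+1 d) = 'C(d + n, n).
Proof.
elim: n d => [|n IH] d.
  rewrite compositionsS size_flatten sumnE !big_map.
  rewrite bin0 -addn1 iotaD add0n big_cat /= big_seq1 subnn /= big_seq big1 //= => k.
  by rewrite mem_iota => Hk; case E : (d - k)%N => //; lia.
rewrite compositionsS size_flatten sumnE !big_map.
rewrite -[iota 0 d.+1]/(index_iota 0 d.+1).
under eq_bigr => k _ do rewrite size_map IH.
have -> : (\sum_(0 <= k < d.+1) 'C(d - k + n, n) = \sum_(0 <= k < d.+1) 'C(k + n, n))%N.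
  rewrite big_nat_rev; apply: eq_big_nat => k Hk; congr 'C(_ + _, _); lia.
elim: d => [|d IHd]; first by rewrite big_nat1 !binn.
by rewrite big_nat_recr //= IHd [in RHS]addSn binS addSnnS.
Qed.

(** * Existence of the Hilbert polynomial *)

(** A subspace of maximal dimension inside a linear predicate exhausts it. *)
Lemma vspace_of_linear_pred (F : fieldType) (vT : vectType F) (P : vT -> Prop) :
  P 0 -> (forall a u v, P u -> P v -> P (a *: u + v)) ->
  exists V : {vspace vT}, forall v, v \in V <-> P v.
Proof.
move=> P0 Plin.
pose sub (V : {vspace vT}) := forall v, v \in V -> P v.
have grow : forall k (V : {vspace vT}), sub V -> (\dim {:vT} - \dim V <= k)%N ->
    exists V' : {vspace vT}, forall v, v \in V' <-> P v.
  elim=> [|k IH] V subV dimV; have [full|/existsNP[v /not_implyP[Pv vV]]] :=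
      pselect (forall v, P v -> v \in V).
  - by exists V => v; split; [apply: subV | apply: full].
  - have : V = {:vT}%VS.
      apply/eqP; rewrite eqEdim subvf /=; lia.
    by move=> Vf; case: vV; rewrite Vf memvf.
  - by exists V => u; split; [apply: subV | apply: full].
  - apply: (IH (V + <[v]>)%VS) => [u /memv_addP[w wV [_ /vlineP[a ->] ->]]|].
      by rewrite addrC; apply: Plin => //; apply: subV.
    have : (\dim V < \dim (V + <[v]>))%N.
      rewrite ltn_neqAle dimvS ?addvSl // andbT; apply/negP => /eqP eqd.
      have : V == (V + <[v]>)%VS by rewrite eqEdim addvSl eqd /=.
      move=> /eqP VE; case: vV; rewrite VE memvE addvSr //.
    lia.
have sub0 : sub 0%VS by move=> v; rewrite memv0 => /eqP->.
exact: grow sub0 (leqnn _).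
Qed.

Lemma mpolyX_neq0 (R : nzRingType) n (m : 'X_{1..n}) : 'X_[m] != 0 :> {mpoly R[n]}.
Proof.
by apply/eqP => /(congr1 (mcoeff m)); rewrite mcoeffX eqxx mcoeff0; apply/eqP/oner_neq0.
Qed.

Section HilbertPolynomial.
Variables (F : fieldType) (n : nat) (X : 'rV[F]_n.+1 -> Prop).

Lemma vanishes_on0 : vanishes_on X 0.
Proof. by move=> v _ _; rewrite /vanishes_at meval0. Qed.

Lemma vanishes_on_lin a (f g : {mpoly F[n.+1]}) :
  vanishes_on X f -> vanishes_on X g -> vanishes_on X (a *: f + g).
Proof.
move=> fX gX v v0 Xv; rewrite /vanishes_at mevalD mevalZ.
by rewrite (fX v v0 Xv) (gX v v0 Xv) mulr0 addr0.
Qed.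

Lemma vanishing_space d : exists V : {vspace dhomog n.+1 F d},
  forall f : dhomog n.+1 F d, f \in V <-> vanishes_on X f.
Proof.
apply: (@vspace_of_linear_pred _ (dhomog n.+1 F d) (fun f => vanishes_on X f)).
  exact: vanishes_on0.
by move=> a f g; apply: vanishes_on_lin.
Qed.

Definition is_leading (m : 'X_{1..n.+1}) : Prop :=
  exists f : {mpoly F[n.+1]},
    [/\ f != 0, f \is (mdeg m).-homog, vanishes_on X f & mlead f = m].

(** Multiplying by a monomial multiplies the leading monomial: the leading
    monomials of an ideal form an up-set. *)
Lemma is_leadingD m m' : is_leading m -> is_leading (m + m')%MM.
Proof.
move=> [f [f0 fh fX fm]]; exists (f * 'X_[m']); split.
- by rewrite mulf_neq0 // mpolyX_neq0.
- by rewrite mdegD dhomogM // dhomogX.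
- by move=> v v0 Xv; rewrite /vanishes_at mevalM (fX v v0 Xv) mul0r.
- by rewrite mleadM ?mpolyX_neq0 // fm mleadXm.
Qed.

Definition mnm_of_seq (s : seq nat) : 'X_{1..n.+1} :=
  [multinom nth 0%N s i | i < n.+1].

Lemma mnm_of_seqK (m : 'X_{1..n.+1}) : mnm_of_seq m = m.
Proof. by apply/mnmP => i; rewrite mnmE -mnm_nth. Qed.

Lemma mnm_of_seq_inj s t : size s = n.+1 -> size t = n.+1 ->
  mnm_of_seq s = mnm_of_seq t -> s = t.
Proof.
move=> ss st /mnmP eqm; apply: (@eq_from_nth _ 0%N) => [|i]; rewrite ss // => ltin.
by have := eqm (Ordinal ltin); rewrite !mnmE.
Qed.

Lemma mdeg_mnm_of_seq s : size s = n.+1 -> mdeg (mnm_of_seq s) = sumn s.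
Proof.
move=> ss; rewrite mdegE sumnE (big_nth 0%N) ss big_mkord.
by apply: eq_bigr => i _; rewrite mnmE.
Qed.

Definition leading_exponents : pred (seq nat) :=
  fun s => `[< is_leading (mnm_of_seq s) >].

Lemma leading_exponents_up : up_closed n.+1 leading_exponents.
Proof.
move=> s t ss st /asboolP ls; apply/asboolP.
have -> : mnm_of_seq t = (mnm_of_seq s + (mnm_of_seq t - mnm_of_seq s))%MM.
  apply/mnmP => i; rewrite mnmDE mnmBE !mnmE subnKC //.
  have := st; rewrite /pointwise_le all2E => /andP[/eqP sst /(all_nthP (0%N, 0%N))].
  move=> /(_ i); rewrite size_zip -sst ss minnn nth_zip //=; exact.
exact: is_leadingD.
Qed.

Definition standard_monomials d : seq 'X_{1..n.+1} :=
  [seq mnm_of_seq s | s <- compositions n.+1 d & ~~ leading_exponents s].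

Lemma size_standard_monomials d :
  size (standard_monomials d) = count_outside n.+1 leading_exponents d.
Proof. by rewrite size_map size_filter. Qed.

Lemma mem_standard_monomials d m :
  (m \in standard_monomials d) <-> (mdeg m = d /\ ~ is_leading m).
Proof.
split=> [/mapP[s]|[dm nm]].
  rewrite mem_filter mem_compositions => /and3P[/asboolPn nl /eqP ss /eqP sd] ->.
  by rewrite mdeg_mnm_of_seq.
apply/mapP; exists (val m : seq nat); last by rewrite mnm_of_seqK.
rewrite mem_filter mem_compositions size_tuple eqxx /=.
apply/andP; split; first by apply/asboolPn; rewrite mnm_of_seqK.
by rewrite -mdeg_mnm_of_seq ?size_tuple // mnm_of_seqK dm.
Qed.

Lemma uniq_standard_monomials d : uniq (standard_monomials d).
Proof.
rewrite map_inj_in_uniq ?filter_uniq ?uniq_compositions // => s t.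
rewrite !mem_filter !mem_compositions.
by move=> /and3P[_ /eqP ss _] /and3P[_ /eqP st _]; apply: mnm_of_seq_inj.
Qed.

Lemma indhomogE d (p : {mpoly F[n.+1]}) : p \is d.-homog -> val (indhomog d p) = p.
Proof. by move=> hp; rewrite /indhomog insubdK. Qed.

Definition standard_basis d : seq (dhomog n.+1 F d) :=
  [seq indhomog d ('X_[m] : {mpoly F[n.+1]}) | m <- standard_monomials d].

Lemma val_standard_basis d i : (i < size (standard_basis d))%N ->
  val (standard_basis d)`_i = 'X_[nth 0%MM (standard_monomials d) i].
Proof.
rewrite size_map => lti; rewrite (nth_map 0%MM) // indhomogE // dhomogX.
by have /mem_standard_monomials[dm _] := mem_nth 0%MM lti; apply/eqP.
Qed.

Lemma free_standard_basis d : free (standard_basis d).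
Proof.
rewrite -[standard_basis d]/(tval (in_tuple (standard_basis d))).
have lts (j : 'I_(size (standard_basis d))) : (j < size (standard_monomials d))%N.
  by have := ltn_ord j; rewrite [X in (_ < X)%N]size_map.
apply/freeP => k k0 i.
have := congr1 (fun f : dhomog n.+1 F d =>
   (val f)@_(nth 0%MM (standard_monomials d) i)) k0.
rewrite /= mcoeff0 !raddf_sum /= (bigD1 i) //= big1 ?addr0.
  by rewrite mcoeffZ val_standard_basis // mcoeffX eqxx mulr1.
move=> j ji; rewrite mcoeffZ val_standard_basis // mcoeffX.
rewrite nth_uniq ?uniq_standard_monomials ?lts //.
by rewrite val_eqE (negbTE ji) mulr0.
Qed.

Lemma msupp_standard_span d (f : dhomog n.+1 F d) m :
  f \in <<standard_basis d>>%VS -> m \in msupp (val f) -> m \in standard_monomials d.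
Proof.
rewrite -[standard_basis d]/(tval (in_tuple (standard_basis d))).
move=> /coord_span ->; apply: contraTT => mN; rewrite mcoeff_msupp negbK.
rewrite !raddf_sum /= big1 // => i _.
rewrite mcoeffZ val_standard_basis // mcoeffX; case: eqP => [em|]; last by rewrite mulr0.
case/negP: mN; rewrite -em mem_nth //.
by have := ltn_ord i; rewrite [X in (_ < X)%N]size_map.
Qed.

(** Macaulay's theorem: the monomials that are not leading monomials of the ideal
    form a basis of the quotient.  They span because a leading monomial can be
    replaced by smaller ones, and they are independent because a nonzero element
    of the ideal has its leading monomial in the ideal of leading monomials. *)
Lemma hilbert_function_standard d :
  hilbert_function X d (size (standard_monomials d)).
Proof.
have [V VP] := vanishing_space d; exists V; split=> //.
have lead_in (f : dhomog n.+1 F d) : f != 0 -> mdeg (mlead (val f)) = d.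
  move=> f0; have f0' : val f != 0 by rewrite -(inj_eq val_inj) in f0.
  exact: (dhomog_mf (valP f) (mlead_supp f0')).
suff -> : fullv = (V + <<standard_basis d>>)%VS.
  rewrite dimv_disjoint_sum.
    by rewrite (eqP (free_standard_basis d)) size_map.
  apply/eqP; rewrite -subv0; apply/subvP => f; rewrite memv_cap memv0.
  case/andP=> fV fS; apply: contraT => f0.
  have f0' : val f != 0 by rewrite -(inj_eq val_inj) in f0.
  have /mem_standard_monomials[_ []] := msupp_standard_span fS (mlead_supp f0').
  exists (val f); split=> //; last exact/VP.
  by rewrite lead_in //; apply: valP.
apply/eqP; rewrite eqEsubv subvf andbT; apply/subvP => f _.
suff H m : forall f : dhomog n.+1 F d, mlead (val f) = m ->
    f \in (V + <<standard_basis d>>)%VS by exact: H (erefl _).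
elim/(well_founded_ind (@ltom_wf n.+1)): m => m IH {}f fm.
have [->|f0] := eqVneq f 0; first exact: mem0v.
have [g gV gm] : exists2 g : dhomog n.+1 F d,
    g \in (V + <<standard_basis d>>)%VS & val g != 0 /\ mlead (val g) = m.
  have md : mdeg m = d by rewrite -fm lead_in.
  have [[g [g0 gh gX gm]]|nm] := pselect (is_leading m).
    have gE : val (indhomog d g) = g by rewrite indhomogE // -md.
    exists (indhomog d g); last by rewrite gE.
    by apply: (subvP (addvSl _ _)); apply/VP; rewrite -[X in vanishes_on _ X]gE in gX.
  have XE : val (indhomog d ('X_[m] : {mpoly F[n.+1]})) = 'X_[m].
    by rewrite indhomogE // dhomogX; apply/eqP.
  exists (indhomog d 'X_[m]); last by rewrite XE mpolyX_neq0 mleadXm.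
  apply: (subvP (addvSr _ _)); apply/memv_span/map_f.
  exact/mem_standard_monomials.
pose c := (val f)@_m / (val g)@_m; pose f' : dhomog n.+1 F d := f - c *: g.
have -> : f = f' + c *: g by rewrite subrK.
rewrite memvD ?memvZ //.
have [f'0|f'0] := eqVneq (val f') 0.
  have -> : f' = 0 by apply: val_inj.
  exact: mem0v.
apply: (IH (mlead (val f'))) => //; case: gm => g0 gm.
have gm0 : (val g)@_m != 0 by rewrite -gm mleadc_eq0.
have f'm : (val f')@_m = 0.
  by rewrite /= mcoeffB mcoeffZ divfK // subrr.
rewrite lt_neqAle; apply/andP; split.
  by apply: contraNneq f'0 => fm'; rewrite -mleadc_eq0 -[X in _@_X]/(mlead (val f')) fm' f'm.
apply: le_trans (mleadB_le _ _) _; rewrite leUx.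
apply/andP; split; first by rewrite -fm.
by apply: le_trans (mleadZ_le _ _) _; rewrite -gm.
Qed.

Lemma hilbert_polynomial_exists : exists P, hilbert_polynomial X P.
Proof.
have [P [d0 PE]] := count_outside_eventually_poly leading_exponents_up.
exists P, d0 => d led; exists (size (standard_monomials d)); split.
  exact: hilbert_function_standard.
by rewrite PE // size_standard_monomials.
Qed.

End HilbertPolynomial.

(** * Recognising degree 16 from quartic bounds *)

(** The bound is strengthened to a fixed negative constant so that it survives
    multiplication by the variable in the induction. *)
Lemma lead_coef_lt0_eventually (P : {poly rat}) : lead_coef P < 0 ->
  exists (e : rat) (d0 : nat), 0 < e /\ forall d, (d0 <= d)%N -> P.[d%:R] <= - e.
Proof.
elim/poly_ind: P => [|P c IH]; first by rewrite lead_coef0 ltxx.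
have [->|P0] := eqVneq P 0.
  rewrite mul0r add0r lead_coefC => c0; exists (- c), 0%N; split; first by rewrite oppr_gt0.
  by move=> d _; rewrite hornerC opprK.
rewrite lead_coefDl ?lead_coefMX => [/IH[e [d0 [e0 Pe]]]|]; last first.
  rewrite size_polyC size_mulX // ltnS; case: (c == 0) => //=.
  by rewrite lt0n size_poly_eq0.
have [N HN] : exists N : nat, (`|c| + 1) / e <= N%:R.
  exists (Num.bound ((`|c| + 1) / e)); apply/ltW; apply: le_lt_trans (archi_boundP _).
    by [].
  by rewrite divr_ge0 ?ltW // ltr_pwDr.
exists 1, (maxn d0 N); split=> // d; rewrite geq_max => /andP[d0d Nd].
rewrite !hornerE; have := Pe d d0d; set p := P.[_] => pe.
have dN : (`|c| + 1) / e <= d%:R by apply: le_trans HN _; rewrite ler_nat.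
have {}dN : `|c| + 1 <= d%:R * e by rewrite -ler_pdivrMr.
have : p * d%:R <= - e * d%:R by rewrite ler_wpM2r.
have := ler_norm c; lra.
Qed.

Lemma lead_coef_ge0 (P : {poly rat}) (d0 : nat) :
  (forall d, (d0 <= d)%N -> 0 <= P.[d%:R]) -> 0 <= lead_coef P.
Proof.
move=> P0; rewrite leNgt; apply/negP => /lead_coef_lt0_eventually[e [d1 [e0 Pe]]].
have := P0 (maxn d0 d1) (leq_maxl _ _); have := Pe (maxn d0 d1) (leq_maxr _ _).
lra.
Qed.

Lemma lead_coef_le_of_eventually_le (P Q : {poly rat}) (d0 : nat) :
  (forall d, (d0 <= d)%N -> P.[d%:R] <= Q.[d%:R]) -> 0 <= lead_coef P ->
  (size P <= size Q)%N /\ P`_(size Q).-1 <= lead_coef Q.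
Proof.
move=> PQ lP.
have : 0 <= lead_coef (Q - P).
  by apply: (@lead_coef_ge0 _ d0) => d led; rewrite hornerD hornerN subr_ge0 PQ.
have szPQ : 0 <= lead_coef (Q - P) -> (size P <= size Q)%N.
  move=> D0; rewrite leqNgt; apply/negP => ltQP; move: D0.
  rewrite addrC lead_coefDl ?size_polyN // lead_coefN oppr_ge0 => lP'.
  have : lead_coef P == 0 by rewrite eq_le lP lP'.
  by rewrite lead_coef_eq0 => /eqP P0; rewrite P0 size_poly0 in ltQP.
move=> D0; split; first exact: szPQ.
have := szPQ D0; move: D0; rewrite /lead_coef => D0 sz.
have [|lt] := eqVneq (size (Q - P)) (size Q).
  by move=> sz'; rewrite sz' coefB subr_ge0 in D0.
have : (size (Q - P)%R < size Q)%N.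
  rewrite ltn_neqAle lt (leq_trans (size_polyD _ _)) // geq_max leqnn size_polyN.
  by rewrite sz.
have [->|Q0] := posnP (size Q); first by [].
move=> lt'; suff : (Q - P)`_(size Q).-1 = 0.
  by rewrite coefB => /eqP; rewrite subr_eq0 => /eqP->.
by apply/(leq_sizeP _ _ (leqnn _)); lia.
Qed.

(** The lower bound forces degree at least 4 and leading coefficient at least
    2/3; the bound on two consecutive values, whose leading coefficient is twice
    that of [P], forces the reverse inequalities.  Finally 4! * 2/3 = 16. *)
Lemma degree16_of_bounds (P : {poly rat}) (K : rat) (d0 : nat) :
  (forall d, (d0 <= d)%N -> 0 <= P.[d%:R]) ->
  (forall d, (d0 <= d)%N -> 2 / 3 * d%:R ^+ 4 - K * d%:R ^+ 3 <= P.[d%:R]) ->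
  (forall d, (d0 <= d)%N ->
     P.[d.+1%:R] + P.[d%:R] <= 4 / 3 * d%:R ^+ 4 + K * d%:R ^+ 3) ->
  ((size P).-1)`!%:R * lead_coef P = 16.
Proof.
move=> P0 lowP upP; have lP := lead_coef_ge0 P0.
pose quartic (a b : rat) := Poly [:: 0; 0; 0; b; a].
have sz_quartic a b : a != 0 -> size (quartic a b) = 5 :> nat.
  by move=> a0; rewrite (@PolyK _ 1).
have quarticE a b x : (quartic a b).[x] = a * x ^+ 4 + b * x ^+ 3.
  by rewrite horner_Poly /=; ring.
have lead_quartic a b : a != 0 -> lead_coef (quartic a b) = a.
  by move=> a0; rewrite /lead_coef sz_quartic // (@PolyK _ 1).
have [| |szl ll] := @lead_coef_le_of_eventually_le (quartic (2 / 3) (- K)) P d0.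
- by move=> d led; rewrite quarticE mulNr; apply: lowP.
- by rewrite lead_quartic.
rewrite sz_quartic // in szl.
pose T := P \Po ('X + 1%:P) + P.
have szX1 : size ('X + 1%:P : {poly rat}) = 2 by rewrite size_XaddC.
have szC : size (P \Po ('X + 1%:P)) = size P by rewrite size_comp_poly2.
have coefT : T`_(size P).-1 = lead_coef P *+ 2.
  rewrite coefD -{1}szC -[X in X + _]/(lead_coef _) lead_coef_comp ?szX1 //.
  by rewrite lead_coefXaddC expr1n mulr1.
have P_neq0 : lead_coef P != 0.
  by rewrite lead_coef_eq0 -size_poly_eq0; case: (size P) szl.
have szT : size T = size P.
  apply/eqP; rewrite eqn_leq (leq_trans (size_polyD _ _)) ?szC ?maxnn //=.
  have : T`_(size P).-1 != 0 by rewrite coefT mulrn_eq0.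
  rewrite leqNgt; apply: contraNN => lt; rewrite nth_default //.
  by case: (size P) szl lt.
have leadT : lead_coef T = lead_coef P *+ 2 by rewrite /lead_coef szT coefT.
have [| |szu lu] := @lead_coef_le_of_eventually_le T (quartic (4 / 3) K) d0.
- move=> d led; rewrite quarticE hornerD horner_comp hornerD hornerX hornerC.
  by rewrite natr1; apply: upP.
- by rewrite leadT mulrn_wge0.
rewrite sz_quartic // szT in szu.
have sz5 : size P = 5%N by apply/eqP; rewrite eqn_leq szu szl.
move: lu ll coefT; rewrite lead_quartic // sz_quartic // sz5 (@PolyK _ 1) //=.
move=> lu ll coefT; rewrite coefT in lu.
have -> : lead_coef P = 2 / 3 by lra.
by rewrite (_ : (4`! = 24)%N) //; lra.
Qed.

Lemma bin4E k : 'C(k + 4, 4)%:R = (k%:R + 1) * (k%:R + 2) * (k%:R + 3) * (k%:R + 4) / 24 :> rat.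
Proof.
have := bin_ffact (k + 4) 4; rewrite !addnS addn0 !ffactnS ffactn0 /=.
move/(congr1 (fun n => n%:R : rat)); rewrite !natrM -!natr1 => e.
apply: (mulIf (_ : (24 : rat) != 0)) => //; rewrite divfK // -[24]/(4`!%:R) e.
by ring.
Qed.

Lemma bin3E k : 'C(k + 3, 3)%:R = (k%:R + 1) * (k%:R + 2) * (k%:R + 3) / 6 :> rat.
Proof.
have := bin_ffact (k + 3) 3; rewrite !addnS addn0 !ffactnS ffactn0 /=.
move/(congr1 (fun n => n%:R : rat)); rewrite !natrM -!natr1 => e.
apply: (mulIf (_ : (6 : rat) != 0)) => //; rewrite divfK // -[6]/(3`!%:R) e.
by ring.
Qed.

Lemma bin2E k : 'C(k + 2, 2)%:R = (k%:R + 1) * (k%:R + 2) / 2 :> rat.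
Proof.
have := bin_ffact (k + 2) 2; rewrite !addnS addn0 !ffactnS ffactn0 /=.
move/(congr1 (fun n => n%:R : rat)); rewrite !natrM -!natr1 => e.
apply: (mulIf (_ : (2 : rat) != 0)) => //; rewrite divfK // -[2]/(2`!%:R) e.
by ring.
Qed.

(** The product dominates [x^4], and [x^4 - (x + a)^4 + 4 a (x + a)^3] is a sum
    of squares. *)
Lemma rising_product_ge (x a : rat) : 0 <= x -> 0 <= a ->
  (x + a) ^+ 4 - 4 * a * (x + a) ^+ 3 <= x * (x + 1) * (x + 2) * (x + 3).
Proof.
move=> x0 a0; have : x ^+ 4 <= x * (x + 1) * (x + 2) * (x + 3).
  rewrite -subr_ge0 (_ : _ - _ = x * (6 * x ^+ 2 + 11 * x + 6)); last by ring.
  by rewrite mulr_ge0 ?addr_ge0 ?mulr_ge0 ?exprn_ge0.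
apply: le_trans; rewrite -subr_ge0.
rewrite (_ : _ - _ = a ^+ 2 * ((2 * x + a) ^+ 2 + 2 * (x + a) ^+ 2)); last by ring.
apply: mulr_ge0; first exact: sqr_ge0.
by apply: addr_ge0; [|apply: mulr_ge0 => //]; apply: sqr_ge0.
Qed.

Lemma shifted_power_le (x c : rat) : 0 <= c -> c <= x ->
  (x + c) ^+ 4 <= x ^+ 4 + 15 * c * x ^+ 3.
Proof.
move=> c0 cx; have x0 : 0 <= x by apply: le_trans cx.
have m1 : c * (c * x ^+ 2) <= c * x ^+ 3.
  by rewrite exprSr [_ * x]mulrC ler_wpM2l // ler_wpM2r // sqr_ge0.
have m2 : c * (c * (c * x)) <= c * x ^+ 3.
  rewrite !exprS expr0 mulr1; apply: ler_wpM2l => //.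
  by apply: ler_pM; rewrite ?mulr_ge0 //; apply: ler_wpM2r.
have m3 : c * (c * (c * c)) <= c * x ^+ 3.
  rewrite !exprS expr0 mulr1; apply: ler_wpM2l => //.
  by apply: ler_pM; rewrite ?mulr_ge0 //; apply: ler_pM.
have -> : (x + c) ^+ 4 = x ^+ 4 + 4 * (c * x ^+ 3) + 6 * (c * (c * x ^+ 2)) +
   4 * (c * (c * (c * x))) + c * (c * (c * c)) by ring.
move: m1 m2 m3; rewrite -mulrA; move: (c * x ^+ 3) (c * (c * x ^+ 2)) (c * (c * (c * x))) (c * (c * (c * c))).
move=> *; lra.
Qed.

(** The binomial hypotheses are the exact counts produced below; their leading
    terms are (2/3) d^4 = (16/4!) d^4 and (4/3) d^4. *)
Lemma has_degree16 (F : fieldType) n (X : 'rV[F]_n.+1 -> Prop) :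
  (forall k h, hilbert_function X (k + 15) h -> (16 * 'C(k + 4, 4) <= h)%N) ->
  (forall d h h', hilbert_function X d.+1 h -> hilbert_function X d h' ->
     (h + h' <= 2 * (d.+2 * 'C(d.+1 + 3, 3)) + 4 * ('C(d.+1 + 2, 2) * 'C(d.+1 + 2, 2)))%N) ->
  has_degree X 16.
Proof.
move=> low up; have [P PX] := hilbert_polynomial_exists X; exists P; split=> //.
have [d0 PE] := PX; apply: (@degree16_of_bounds P 100 (maxn d0 15)) => d; rewrite geq_max => /andP[d0d d15].
- by have [h [_ ->]] := PE d d0d; rewrite ler0n.
- have [h [hX ->]] := PE d d0d.
  have dE : d = (d - 15 + 15)%N by rewrite subnK.
  move: hX; rewrite dE => /low; rewrite -(ler_nat rat) natrM bin4E.
  move: (d - 15)%N => k; have -> : (k + 15)%:R = (k%:R + 1) + 14 :> rat by rewrite natrD; ring.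
  have : 0 <= k%:R :> rat by rewrite ler0n.
  move: (k%:R : rat) => x x0; apply: le_trans.
  have := @rising_product_ge (x + 1) 14 (addr_ge0 x0 ler01) (ler0n _ 14).
  have : 0 <= (x + 1 + 14) ^+ 3 by rewrite exprn_ge0 ?addr_ge0.
  have -> : x + 1 + 1 = x + 2 by ring.
  have -> : x + 1 + 2 = x + 3 by ring.
  have -> : x + 1 + 3 = x + 4 by ring.
  move: ((x + 1) * _ * _ * _) (_ ^+ 3) (_ ^+ 4) => A B D; lra.
- have [h [hX ->]] := PE d.+1 (leqW d0d); have [h' [hX' ->]] := PE d d0d.
  have := up d h h' hX hX'; rewrite -(ler_nat rat) natrD [X in _ <= X]natrD.
  rewrite (natrM _ 2) (natrM _ d.+2) (natrM _ 4) natrM bin3E bin2E.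
  rewrite -(natr1 d.+1) -(natr1 d).
  have : 4 <= d%:R :> rat by rewrite (ler_nat _ 4); lia.
  move: (d%:R : rat) => x x4 H; apply: le_trans H _.
  have := @shifted_power_le x 4 (ler0n _ 4) x4.
  have x0 : 0 <= x by lra.
  have le4 (a b c e : rat) : 0 <= a <= 4 -> 0 <= b <= 4 -> 0 <= c <= 4 -> 0 <= e <= 4 ->
      (x + a) * (x + b) * ((x + c) * (x + e)) <= (x + 4) ^+ 4.
    move=> /andP[a0 a4] /andP[b0 b4] /andP[c0 c4] /andP[e0 e4].
    rewrite (_ : _ ^+ 4 = (x + 4) * (x + 4) * ((x + 4) * (x + 4))); last by ring.
    by do ?[apply: ler_pM]; rewrite ?mulr_ge0 ?addr_ge0 ?lerD2l.
  have lB := @le4 2 2 3 4 isT isT isT isT; have lA := @le4 2 2 3 3 isT isT isT isT.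
  have -> : 2 * ((x + 1 + 1) * ((x + 1 + 1) * (x + 1 + 2) * (x + 1 + 3) / 6)) +
      4 * ((x + 1 + 1) * (x + 1 + 2) / 2 * ((x + 1 + 1) * (x + 1 + 2) / 2)) =
      (x + 2) * (x + 2) * ((x + 3) * (x + 4)) / 3 + (x + 2) * (x + 2) * ((x + 3) * (x + 3)).
    by field.
  move=> lC; have : 0 <= x ^+ 3 by rewrite exprn_ge0.
  move: lA lB lC; set A := (x + 2) * (x + 2) * ((x + 3) * (x + 4)).
  set B := (x + 2) * (x + 2) * ((x + 3) * (x + 3)); clearbody A B.
  move: (x ^+ 3) (x ^+ 4) ((x + 4) ^+ 4) => *; lra.
Qed.

(** * Two dimension counts in linear algebra *)

Section LinearAlgebra.
Variable F : fieldType.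

(** More independent functions than spanning ones would give a nonzero vector in
    the kernel of the coefficient matrix. *)
Lemma independent_le_spanning (T : Type) (I : finType) (phi : I -> T -> F)
    (N : nat) (E : 'I_N -> T -> F) (A : I -> 'I_N -> F) :
  (forall i t, phi i t = \sum_j A i j * E j t) ->
  (forall a : I -> F, (forall t, \sum_i a i * phi i t = 0) -> forall i, a i = 0) ->
  (#|I| <= N)%N.
Proof.
move=> phiE indep.
pose B := \matrix_(i < #|I|, j < N) A (enum_val i) j.
suff : row_free B by move/eqP <-; apply: rank_leq_col.
rewrite -kermx_eq0; apply/rowV0P => v /sub_kermxP vB.
apply/rowP => i; rewrite mxE.
have := indep (fun x => v 0 (enum_rank x)) _ (enum_val i); rewrite enum_valK; apply=> t.
rewrite (eq_bigr (fun x => \sum_j v 0 (enum_rank x) * A x j * E j t)); last first.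
  by move=> x _; rewrite phiE mulr_sumr; apply: eq_bigr => j _; rewrite mulrA.
rewrite exchange_big /= big1 // => j _; rewrite -mulr_suml.
have /rowP/(_ j) := vB; rewrite !mxE => vBj.
rewrite (reindex (@enum_val I predT)) /=; last first.
  by apply: onW_bij; apply: enum_val_bij.
rewrite (_ : \sum_(i < _) _ = 0) ?mul0r // -[RHS]vBj.
by apply: eq_bigr => k _; rewrite mxE enum_valK.
Qed.

Lemma independent_mod_le (vT : vectType F) (V : {vspace vT}) (I : finType)
    (u : I -> vT) (h : nat) :
  \dim {:vT} = (\dim V + h)%N ->
  (forall a : I -> F, \sum_i a i *: u i \in V -> forall i, a i = 0) ->
  (#|I| <= h)%N.
Proof.
move=> dimE indep.
pose s := [tuple u (enum_val i) | i < #|I|].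
have sE (k : 'I_#|I| -> F) : \sum_i k i *: s`_i = \sum_x k (enum_rank x) *: u x.
  rewrite [RHS](reindex (@enum_val I predT)) /=; last first.
    by apply: onW_bij; apply: enum_val_bij.
  apply: eq_bigr => i _; rewrite enum_valK (nth_map i) ?size_enum_ord //.
  by rewrite nth_ord_enum.
have frees : free s.
  apply/freeP => k; rewrite sE => k0 i.
  rewrite -(enum_valK i); apply: (indep (fun x => k (enum_rank x))).
  by rewrite k0 mem0v.
have cap0 : (V :&: <<s>> = 0)%VS.
  apply/eqP; rewrite -subv0; apply/subvP => v; rewrite memv_cap => /andP[vV vs].
  move: vV; rewrite (coord_span vs) sE => /indep k0.
  by rewrite big1 ?mem0v // => x _; rewrite k0 scale0r.
have := dimvS (subvf (V + <<s>>)%VS).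
by rewrite dimv_disjoint_sum // (eqP frees) size_tuple dimE leq_add2l.
Qed.

End LinearAlgebra.

(** * Products of two binary cubics *)

Section Cubics.
Variable F : fieldType.
Implicit Types (f g : nat -> F) (a b : seq nat).

(** The form f0 x^3 + 3 f1 x^2 y + 3 f2 x y^2 + f3 y^3 at x = 1; with binomial
    coefficients the covariants below have simple formulas. *)
Definition cubic f : {poly F} := Poly [:: f 0%N; 3%:R * f 1%N; 3%:R * f 2%N; f 3%N].

(** The coordinates of a binary sextic given by its value at x = 1, y = X. *)
Definition sextic_vec (p : {poly F}) : 'rV[F]_7 := \row_(i < 7) p`_i.

Definition bimonomial a b f g : F :=
  (\prod_(i < 4) f i ^+ nth 0%N a i) * (\prod_(i < 4) g i ^+ nth 0%N b i).

Definition bihomogeneous (d e : nat) (phi : (nat -> F) -> (nat -> F) -> F) : Prop :=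
  exists l : seq (F * (seq nat * seq nat)),
    (forall x, x \in l -> x.2.1 \in compositions 4 d /\ x.2.2 \in compositions 4 e) /\
    (forall f g, phi f g = \sum_(x <- l) x.1 * bimonomial x.2.1 x.2.2 f g).

Lemma bihomogeneous_bimonomial d e a b :
  a \in compositions 4 d -> b \in compositions 4 e ->
  bihomogeneous d e (bimonomial a b).
Proof.
move=> ad be; exists [:: (1, (a, b))]; split=> [x|f g].
  by rewrite inE => /eqP->.
by rewrite big_seq1 mul1r.
Qed.

Lemma bihomogeneous_ext d e phi psi :
  (forall f g, phi f g = psi f g) -> bihomogeneous d e phi -> bihomogeneous d e psi.
Proof. by move=> pp [l [lP lE]]; exists l; split=> // f g; rewrite -pp. Qed.

Lemma bihomogeneous0 d e : bihomogeneous d e (fun _ _ => 0).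
Proof. by exists [::]; split=> // f g; rewrite big_nil. Qed.

Lemma bihomogeneousD d e phi psi :
  bihomogeneous d e phi -> bihomogeneous d e psi ->
  bihomogeneous d e (fun f g => phi f g + psi f g).
Proof.
move=> [l [lP lE]] [k [kP kE]]; exists (l ++ k); split=> [x|f g].
  by rewrite mem_cat => /orP[/lP|/kP].
by rewrite big_cat lE kE.
Qed.

Lemma bihomogeneousZ d e c phi :
  bihomogeneous d e phi -> bihomogeneous d e (fun f g => c * phi f g).
Proof.
move=> [l [lP lE]]; exists [seq (c * x.1, x.2) | x <- l]; split=> [x|f g].
  by case/mapP => y /lP yl ->.
by rewrite big_map lE mulr_sumr; apply: eq_bigr => x _; rewrite mulrA.
Qed.

Lemma bimonomialM a b a' b' f g : size a = 4 -> size b = 4 -> size a' = 4 -> size b' = 4 ->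
  bimonomial a b f g * bimonomial a' b' f g =
  bimonomial [seq x.1 + x.2 | x <- zip a a']%N [seq x.1 + x.2 | x <- zip b b']%N f g.
Proof.
move: a b a' b' => [|a0 [|a1 [|a2 [|a3 [|? ?]]]]] // [|b0 [|b1 [|b2 [|b3 [|? ?]]]]] //.
move=> [|c0 [|c1 [|c2 [|c3 [|? ?]]]]] // [|e0 [|e1 [|e2 [|e3 [|? ?]]]]] // _ _ _ _.
by rewrite /bimonomial !big_ord_recl !big_ord0 /= !exprD; ring.
Qed.

Lemma compositionsD n d d' a a' : a \in compositions n d -> a' \in compositions n d' ->
  [seq x.1 + x.2 | x <- zip a a']%N \in compositions n (d + d').
Proof.
rewrite !mem_compositions => /andP[/eqP sa /eqP <-] /andP[/eqP sa' /eqP <-].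
rewrite size_map size_zip sa sa' minnn eqxx /=; apply/eqP.
move: n sa sa'; elim: a a' => [|x a IH] [|y a'] [|n] //= [sa] [sa'].
by rewrite (IH _ n) //; lia.
Qed.

Lemma bihomogeneousM d e d' e' phi psi :
  bihomogeneous d e phi -> bihomogeneous d' e' psi ->
  bihomogeneous (d + d') (e + e') (fun f g => phi f g * psi f g).
Proof.
move=> [l [lP lE]] [k [kP kE]].
pose add (s t : seq nat) := [seq x.1 + x.2 | x <- zip s t]%N.
exists [seq (x.1 * y.1, (add x.2.1 y.2.1, add x.2.2 y.2.2)) | x <- l, y <- k].
split=> [x /allpairsP[[y z] [/= /lP[yd ye] /kP[zd ze] ->]]|f g].
  by split; [exact: (compositionsD yd zd) | exact: (compositionsD ye ze)].
rewrite lE kE big_allpairs_dep mulr_suml big_seq [RHS]big_seq; apply: eq_bigr => x /lP[].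
rewrite !mem_compositions => /andP[/eqP xd _] /andP[/eqP xe _].
rewrite mulr_sumr big_seq [RHS]big_seq; apply: eq_bigr => y /kP[].
rewrite !mem_compositions => /andP[/eqP yd _] /andP[/eqP ye _].
by rewrite /= /add -bimonomialM // mulrACA.
Qed.

Lemma bihomogeneousX d e phi k : bihomogeneous d e phi ->
  bihomogeneous (k * d) (k * e) (fun f g => phi f g ^+ k).
Proof.
move=> phiP; elim: k => [|k IH].
  rewrite !mul0n; apply: bihomogeneous_ext (@bihomogeneous_bimonomial 0 0 (nseq 4 0%N) (nseq 4 0%N) _ _) => //.
  by move=> f g; rewrite /bimonomial !big_ord_recl !big_ord0 /= !expr0 !mulr1.
rewrite !mulSn; apply: bihomogeneous_ext (bihomogeneousM phiP IH).
by move=> f g; rewrite exprS.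
Qed.

Lemma bihomogeneous_fg i j : (i < 4)%N -> (j < 4)%N ->
  bihomogeneous 1 1 (fun f g => f i * g j).
Proof.
move=> i4 j4.
pose e k := [seq (k == l : nat) | l <- iota 0 4].
apply: bihomogeneous_ext (@bihomogeneous_bimonomial 1 1 (e i) (e j) _ _).
- move=> f g; rewrite /bimonomial !big_ord_recl !big_ord0 /=.
  by move: i j i4 j4 => [|[|[|[|?]]]] // [|[|[|[|?]]]] // _ _;
    rewrite /= !expr0 !expr1 ?mulr1 ?mul1r.
- by move: i i4 => [|[|[|[|?]]]].
- by move: j j4 => [|[|[|[|?]]]].
Qed.

Lemma cubicM_coef f g k : (cubic f * cubic g)`_k =
  nth 0 [:: f 0%N * g 0%N;
    3%:R * (f 0%N * g 1%N) + 3%:R * (f 1%N * g 0%N);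
    3%:R * (f 0%N * g 2%N) + 9%:R * (f 1%N * g 1%N) + 3%:R * (f 2%N * g 0%N);
    f 0%N * g 3%N + 9%:R * (f 1%N * g 2%N) + 9%:R * (f 2%N * g 1%N) + f 3%N * g 0%N;
    3%:R * (f 1%N * g 3%N) + 9%:R * (f 2%N * g 2%N) + 3%:R * (f 3%N * g 1%N);
    3%:R * (f 2%N * g 3%N) + 3%:R * (f 3%N * g 2%N);
    f 3%N * g 3%N] k.
Proof.
rewrite coefM; case: (ltnP k 7) => k7; last first.
  rewrite nth_default // big1 // => i _; rewrite !coef_Poly.
  have [i4|i4] := ltnP i 4; last by rewrite nth_default ?mul0r.
  by rewrite [X in _ * X]nth_default ?mulr0 //=; have := ltn_ord i; lia.
move: k k7 => [|[|[|[|[|[|[|?]]]]]]] // _;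
  rewrite !big_ord_recl big_ord0 !coef_Poly /= ?nth_nil /=; ring.
Qed.

Lemma bihomogeneous_cubicM k : bihomogeneous 1 1 (fun f g => (cubic f * cubic g)`_k).
Proof.
apply: (@bihomogeneous_ext _ _ _ _ (fun f g => esym (cubicM_coef f g k))).
move: k => [|[|[|[|[|[|[|k]]]]]]] /=;
  rewrite ?nth_nil; do ?[exact: bihomogeneous_fg | exact: bihomogeneous0
   | apply: bihomogeneousD | apply: bihomogeneousZ].
Qed.

(** The coefficients of a product are bilinear in the factors. *)
Lemma bihomogeneous_sextic d (M : {mpoly F[7]}) : M \is d.-homog ->
  bihomogeneous d d (fun f g => M.@[fun i => sextic_vec (cubic f * cubic g) 0 i]).
Proof.
move=> Mh.
have mono (r : seq 'I_7) (m : 'I_7 -> nat) :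
    bihomogeneous (\sum_(i <- r) m i) (\sum_(i <- r) m i)
      (fun f g => \prod_(i <- r) (cubic f * cubic g)`_i ^+ m i).
  elim: r => [|i r IH].
    rewrite big_nil; apply: bihomogeneous_ext (bihomogeneousX 0 (bihomogeneous0 0 0)).
    by move=> f g; rewrite big_nil expr0.
  rewrite big_cons; have := bihomogeneousM (bihomogeneousX (m i) (bihomogeneous_cubicM i)) IH.
  rewrite !muln1 => H; apply: bihomogeneous_ext H.
  by move=> f g; rewrite big_cons.
have sum (s : seq 'X_{1..7}) : {subset s <= msupp M} -> bihomogeneous d d
    (fun f g => \sum_(m <- s) M@_m * \prod_(i <- enum 'I_7) (cubic f * cubic g)`_i ^+ m i).
  elim: s => [|m s IH] sM.
    by apply: bihomogeneous_ext (bihomogeneous0 d d) => f g; rewrite big_nil.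
  have md : (\sum_(i <- enum 'I_7) m i)%N = d.
    rewrite big_enum -mdegE; apply: (dhomog_mf Mh); apply: sM; exact: mem_head.
  have := bihomogeneousZ M@_m (mono (enum 'I_7) m); rewrite md => Pm.
  apply: bihomogeneous_ext (bihomogeneousD Pm (IH _)) => [f g|k ks].
    by rewrite big_cons.
  by apply: sM; rewrite inE ks orbT.
apply: bihomogeneous_ext (sum (msupp M) _) => // f g.
rewrite mevalE; apply: eq_bigr => m _; rewrite big_enum; congr (_ * _).
by apply: eq_bigr => i _; rewrite mxE.
Qed.

End Cubics.

(** * Mutually apolar cubics and the upper bound *)

Section StandardBimonomials.
Variable F : fieldType.
Implicit Types (f g : nat -> F) (a b : seq nat).

(** Up to a constant, the coefficients of x^2, x y, y^2 in the Hessian of the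
    cubic. *)
Definition hessian f : F * F * F :=
  (f 0%N * f 2%N - f 1%N ^+ 2, f 0%N * f 3%N - f 1%N * f 2%N,
   f 1%N * f 3%N - f 2%N ^+ 2).

(** The second transvectant of [g] with the Hessian of [f], a linear form,
    vanishes: [g] lies in the pencil <u^3, v^3> when the Hessian of [f] is u v. *)
Definition apolar_to_hessian f g : Prop :=
  let: (A, B, C) := hessian f in
  A * g 2%N - B * g 1%N + C * g 0%N = 0 /\ A * g 3%N - B * g 2%N + C * g 1%N = 0.

Definition mutually_apolar f g : Prop :=
  apolar_to_hessian f g /\ apolar_to_hessian g f.

Definition edge_bimonomials d e : seq (seq nat * seq nat) :=
  [seq ([:: nth 0 a 0; nth 0 a 1; e; nth 0 a 2], rcons b 0)%N
     | a <- compositions 3 (d - e), b <- compositions 3 d] ++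
  [seq ([:: nth 0 a 0; e; nth 0 a 1; nth 0 a 2], 0 :: b)%N
     | a <- compositions 3 (d - e), b <- compositions 3 d].

(** The bidegree (d, d) monomials divisible by none of f2^2 g0, f1^2 g3,
    f1 g0 g3, f2 g0 g3.  They lie on four coordinate strata: f1 = f2 = 0,
    g0 = g3 = 0, and the two families where g3 (or g0) is absent and the exponent
    of f2 (or f1) is at most one. *)
Definition standard_bimonomials d : seq (seq nat * seq nat) := undup (
  [seq ([:: k; 0; 0; d - k], b)%N | k <- iota 0 d.+1, b <- compositions 4 d] ++
  [seq (a, [:: 0; k; d - k; 0])%N | k <- iota 0 d.+1, a <- compositions 4 d] ++
  edge_bimonomials d 0 ++ edge_bimonomials d 1).

(** Each of the strata f1 = f2 = 0 and g0 = g3 = 0 contributes d^4/6 and each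
    of the other two d^4/2, which adds up to (4/3) d^4. *)
Lemma size_standard_bimonomials d :
  (size (standard_bimonomials d) <=
   2 * (d.+1 * 'C(d + 3, 3)) + 4 * ('C(d + 2, 2) * 'C(d + 2, 2)))%N.
Proof.
apply: leq_trans (size_undup _) _.
rewrite !size_cat !size_allpairs !size_map !size_iota !size_compositions subn0.
have : ('C(d - 1 + 2, 2) <= 'C(d + 2, 2))%N by apply: leq_bin2l; lia.
move: 'C(d - 1 + 2, 2) 'C(d + 2, 2) 'C(d + 3, 3) => x y z xy.
have : (x * y <= y * y)%N by rewrite leq_mul.
lia.
Qed.

Lemma standard_bimonomialsP d a b :
  a \in compositions 4 d -> b \in compositions 4 d ->
  [|| (nth 0 a 1 == 0) && (nth 0 a 2 == 0), (nth 0 b 0 == 0) && (nth 0 b 3 == 0),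
      (nth 0 a 2 <= 1) && (nth 0 b 3 == 0) | (nth 0 a 1 <= 1) && (nth 0 b 0 == 0)]%N ->
  (a, b) \in standard_bimonomials d.
Proof.
rewrite !mem_compositions => /andP[/eqP sa /eqP da] /andP[/eqP sb /eqP db].
move: a b sa sb da db => [|a0 [|a1 [|a2 [|a3 [|? ?]]]]] // [|b0 [|b1 [|b2 [|b3 [|? ?]]]]] //.
move=> _ _; rewrite [sumn _]/= [sumn _]/= => da db.
rewrite [nth _ _ _]/= [nth _ _ 2]/= [nth _ _ 0]/= [nth _ _ 3]/=.
rewrite mem_undup; case/or4P => /andP[].
- move=> /eqP a10 /eqP a20; rewrite mem_cat; apply/orP; left; apply/allpairsP.
  exists (a0, [:: b0; b1; b2; b3]); split.
  + by rewrite mem_iota /=; lia.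
  + by rewrite mem_compositions /=; apply/eqP; lia.
  + by rewrite a10 a20 /=; congr ([:: _; _; _; _], _); lia.
- move=> /eqP b00 /eqP b30; rewrite mem_cat; apply/orP; right.
  rewrite mem_cat; apply/orP; left; apply/allpairsP.
  exists (b1, [:: a0; a1; a2; a3]); split.
  + by rewrite mem_iota /=; lia.
  + by rewrite mem_compositions /=; apply/eqP; lia.
  + by rewrite b00 b30 /=; congr (_, [:: _; _; _; _]); lia.
- move=> a21 /eqP b30; rewrite mem_cat; apply/orP; right.
  rewrite mem_cat; apply/orP; right.
  suff H : ([:: a0; a1; a2; a3], [:: b0; b1; b2; b3]) \in edge_bimonomials d a2.
    rewrite mem_cat; apply/orP.
    by have [e|e] : (a2 = 0 \/ a2 = 1)%N by [move: a21 => /=; lia]; [left|right]; move: H; rewrite e.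
  rewrite mem_cat; apply/orP; left; apply/allpairsP.
  exists ([:: a0; a1; a3], [:: b0; b1; b2]); split.
  + by rewrite mem_compositions /=; apply/eqP; lia.
  + by rewrite mem_compositions /=; apply/eqP; lia.
  + by rewrite b30.
- move=> a11 /eqP b00; rewrite mem_cat; apply/orP; right.
  rewrite mem_cat; apply/orP; right.
  suff H : ([:: a0; a1; a2; a3], [:: b0; b1; b2; b3]) \in edge_bimonomials d a1.
    rewrite mem_cat; apply/orP.
    by have [e|e] : (a1 = 0 \/ a1 = 1)%N by [move: a11 => /=; lia]; [left|right]; move: H; rewrite e.
  rewrite mem_cat; apply/orP; right; apply/allpairsP.
  exists ([:: a0; a2; a3], [:: b1; b2; b3]); split.
  + by rewrite mem_compositions /=; apply/eqP; lia.
  + by rewrite mem_compositions /=; apply/eqP; lia.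
  + by rewrite b00.
Qed.

Definition in_standard_span d (phi : (nat -> F) -> (nat -> F) -> F) : Prop :=
  exists c : seq nat * seq nat -> F, forall f g, mutually_apolar f g ->
    phi f g = \sum_(x <- standard_bimonomials d) c x * bimonomial x.1 x.2 f g.

Lemma in_standard_span_ext d phi psi :
  (forall f g, mutually_apolar f g -> phi f g = psi f g) ->
  in_standard_span d psi -> in_standard_span d phi.
Proof. by move=> pp [c cE]; exists c => f g fg; rewrite pp // cE. Qed.

Lemma in_standard_spanD d phi psi :
  in_standard_span d phi -> in_standard_span d psi ->
  in_standard_span d (fun f g => phi f g + psi f g).
Proof.
move=> [c cE] [e eE]; exists (fun x => c x + e x) => f g fg.
by rewrite cE // eE // -big_split; apply: eq_bigr => x _; rewrite mulrDl.
Qed.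

Lemma in_standard_spanZ d k phi :
  in_standard_span d phi -> in_standard_span d (fun f g => k * phi f g).
Proof.
move=> [c cE]; exists (fun x => k * c x) => f g fg.
by rewrite cE // mulr_sumr; apply: eq_bigr => x _; rewrite mulrA.
Qed.

Lemma in_standard_spanN d phi :
  in_standard_span d phi -> in_standard_span d (fun f g => - phi f g).
Proof.
move=> H; apply: in_standard_span_ext (in_standard_spanZ (-1) H) => f g _.
by rewrite mulN1r.
Qed.

Lemma in_standard_span0 d : in_standard_span d (fun _ _ => 0).
Proof. by exists (fun _ => 0) => f g _; rewrite big1 // => x _; rewrite mul0r. Qed.

Lemma in_standard_span_mem d a b :
  (a, b) \in standard_bimonomials d -> in_standard_span d (bimonomial a b).
Proof.
move=> abs; exists (fun x => (x == (a, b))%:R) => f g _.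
rewrite (bigD1_seq (a, b)) ?undup_uniq //= eqxx mul1r big1 ?addr0 // => x /negbTE ->.
by rewrite mul0r.
Qed.

(** This weight makes f2^2 g0, f1^2 g3, f1 g0 g3, f2 g0 g3 the unique heaviest
    terms of the four apolarity relations. *)
Definition weight a b := (nth 0 a 1 + nth 0 a 2 + 3 * (nth 0 b 0 + nth 0 b 3))%N.

(** Each apolarity relation rewrites its heaviest monomial in terms of lighter
    ones of the same bidegree; descent on the weight ends with standard
    bimonomials. *)
Lemma in_standard_span_bimonomial d a b :
  a \in compositions 4 d -> b \in compositions 4 d ->
  in_standard_span d (bimonomial a b).
Proof.
have [w] := ubnP (weight a b).
elim: w a b => // w IH a b; rewrite ltnS => wab ad bd.
have [std|] := boolP [|| (nth 0 a 1 == 0) && (nth 0 a 2 == 0), (nth 0 b 0 == 0) && (nth 0 b 3 == 0),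
      (nth 0 a 2 <= 1) && (nth 0 b 3 == 0) | (nth 0 a 1 <= 1) && (nth 0 b 0 == 0)]%N.
  exact/in_standard_span_mem/standard_bimonomialsP.
move: ad bd wab; rewrite !mem_compositions => /andP[/eqP sa /eqP da] /andP[/eqP sb /eqP db].
move: a b sa sb da db => [|a0 [|a1 [|a2 [|a3 [|? ?]]]]] // [|b0 [|b1 [|b2 [|b3 [|? ?]]]]] //.
move=> _ _; rewrite [sumn _]/= [sumn _]/= /weight.
rewrite [nth _ _ _]/= [nth _ _ 2]/= [nth _ _ 0]/= [nth _ _ 3]/= => da db wab nstd.
have smaller a b : size a = 4 -> size b = 4 -> sumn a = d -> sumn b = d ->
  (weight a b < a1 + a2 + 3 * (b0 + b3))%N -> in_standard_span d (bimonomial a b).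
  move=> sa sb da' db' lw; apply: IH; last by rewrite mem_compositions sb db' !eqxx.
    exact: leq_trans lw wab.
  by rewrite mem_compositions sa da' !eqxx.
have : [|| (1 < a2) && (0 < b0), (1 < a1) && (0 < b3),
          [&& 0 < a1, 0 < b0 & 0 < b3] | [&& 0 < a2, 0 < b0 & 0 < b3]]%N by lia.
case/or4P; [case/andP | case/andP | case/and3P | case/and3P].
- case: a2 da db smaller {wab nstd IH} => [|[|a2]] // da db smaller _.
  case: b0 da db smaller => [|b0] // da db smaller _.
  apply: (in_standard_span_ext (psi := fun f g =>
    bimonomial [:: a0.+1; a1; a2.+1; a3]%N [:: b0; b1; b2.+1; b3]%N f g +
    (- bimonomial [:: a0; a1.+1.+1; a2; a3]%N [:: b0; b1; b2.+1; b3]%N f g +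
    (- bimonomial [:: a0.+1; a1; a2; a3.+1]%N [:: b0; b1.+1; b2; b3]%N f g +
    (bimonomial [:: a0; a1.+1; a2.+1; a3]%N [:: b0; b1.+1; b2; b3]%N f g +
    (bimonomial [:: a0; a1.+1; a2; a3.+1]%N [:: b0.+1; b1; b2; b3]%N f g)))))) => [f g [[E _] _]|].
    apply/eqP; rewrite -subr_eq0
      -[X in _ == X](mulr0 (- (bimonomial [:: a0; a1; a2; a3]%N [:: b0; b1; b2; b3]%N f g))) -E.
    by rewrite /bimonomial !big_ord_recl !big_ord0 /= !exprS; apply/eqP; ring.
  by repeat first [apply: in_standard_spanD | apply: in_standard_spanN];
    apply: smaller; rewrite /weight //=; lia.
- case: a1 da db smaller {wab nstd IH} => [|[|a1]] // da db smaller _.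
  case: b3 da db smaller => [|b3] // da db smaller _.
  apply: (in_standard_span_ext (psi := fun f g =>
    bimonomial [:: a0.+1; a1; a2.+1; a3]%N [:: b0; b1; b2; b3.+1]%N f g +
    (- bimonomial [:: a0.+1; a1; a2; a3.+1]%N [:: b0; b1; b2.+1; b3]%N f g +
    (bimonomial [:: a0; a1.+1; a2.+1; a3]%N [:: b0; b1; b2.+1; b3]%N f g +
    (bimonomial [:: a0; a1.+1; a2; a3.+1]%N [:: b0; b1.+1; b2; b3]%N f g +
    (- bimonomial [:: a0; a1; a2.+1.+1; a3]%N [:: b0; b1.+1; b2; b3]%N f g)))))) => [f g [[_ E] _]|].
    apply/eqP; rewrite -subr_eq0
      -[X in _ == X](mulr0 (- (bimonomial [:: a0; a1; a2; a3]%N [:: b0; b1; b2; b3]%N f g))) -E.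
    by rewrite /bimonomial !big_ord_recl !big_ord0 /= !exprS; apply/eqP; ring.
  by repeat first [apply: in_standard_spanD | apply: in_standard_spanN];
    apply: smaller; rewrite /weight //=; lia.
- case: a1 da db smaller {wab nstd IH} => [|a1] // da db smaller _.
  case: b0 da db smaller => [|b0] // da db smaller _.
  case: b3 da db smaller => [|b3] // da db smaller _.
  apply: (in_standard_span_ext (psi := fun f g =>
    bimonomial [:: a0; a1; a2.+1; a3]%N [:: b0.+1; b1; b2.+1; b3]%N f g +
    (- bimonomial [:: a0; a1; a2.+1; a3]%N [:: b0; b1.+1.+1; b2; b3]%N f g +
    (bimonomial [:: a0; a1.+1; a2; a3]%N [:: b0; b1.+1; b2.+1; b3]%N f g +
    (bimonomial [:: a0.+1; a1; a2; a3]%N [:: b0; b1.+1; b2; b3.+1]%N f g +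
    (- bimonomial [:: a0.+1; a1; a2; a3]%N [:: b0; b1; b2.+1.+1; b3]%N f g)))))) => [f g [_ [E _]]|].
    apply/eqP; rewrite -subr_eq0
      -[X in _ == X](mulr0 (- (bimonomial [:: a0; a1; a2; a3]%N [:: b0; b1; b2; b3]%N f g))) -E.
    by rewrite /bimonomial !big_ord_recl !big_ord0 /= !exprS; apply/eqP; ring.
  by repeat first [apply: in_standard_spanD | apply: in_standard_spanN];
    apply: smaller; rewrite /weight //=; lia.
- case: a2 da db smaller {wab nstd IH} => [|a2] // da db smaller _.
  case: b0 da db smaller => [|b0] // da db smaller _.
  case: b3 da db smaller => [|b3] // da db smaller _.
  apply: (in_standard_span_ext (psi := fun f g =>
    bimonomial [:: a0; a1; a2; a3.+1]%N [:: b0.+1; b1; b2.+1; b3]%N f g +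
    (- bimonomial [:: a0; a1; a2; a3.+1]%N [:: b0; b1.+1.+1; b2; b3]%N f g +
    (bimonomial [:: a0; a1; a2.+1; a3]%N [:: b0; b1.+1; b2.+1; b3]%N f g +
    (bimonomial [:: a0; a1.+1; a2; a3]%N [:: b0; b1.+1; b2; b3.+1]%N f g +
    (- bimonomial [:: a0; a1.+1; a2; a3]%N [:: b0; b1; b2.+1.+1; b3]%N f g)))))) => [f g [_ [_ E]]|].
    apply/eqP; rewrite -subr_eq0
      -[X in _ == X](mulr0 (- (bimonomial [:: a0; a1; a2; a3]%N [:: b0; b1; b2; b3]%N f g))) -E.
    by rewrite /bimonomial !big_ord_recl !big_ord0 /= !exprS; apply/eqP; ring.
  by repeat first [apply: in_standard_spanD | apply: in_standard_spanN];
    apply: smaller; rewrite /weight //=; lia.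
Qed.

End StandardBimonomials.

Section UpperBound.
Variable F : fieldType.
Implicit Types (f g : nat -> F).

Lemma bihomogeneous_in_standard_span d phi :
  bihomogeneous d d phi -> @in_standard_span F d phi.
Proof.
move=> [l [lP phiE]].
apply: (in_standard_span_ext (psi := fun f g => \sum_(x <- l) x.1 * bimonomial x.2.1 x.2.2 f g)).
  by move=> f g _.
elim: l lP {phiE} => [|x l IH] lP.
  by apply: in_standard_span_ext (in_standard_span0 _ d) => f g _; rewrite big_nil.
apply: in_standard_span_ext (in_standard_spanD (in_standard_spanZ x.1
  (in_standard_span_bimonomial F (proj1 (lP x (mem_head _ _))) (proj2 (lP x (mem_head _ _)))))
  (IH (fun y yl => lP y (mem_behead (s := x :: l) yl)))).
by move=> f g _; rewrite big_cons.
Qed.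

(** The third transvectant of two cubics: the invariant alternating form, which
    does not vanish on independent members of a pencil <u^3, v^3>. *)
Definition symplectic f g : F :=
  f 0%N * g 3%N - 3%:R * (f 1%N * g 2%N) + 3%:R * (f 2%N * g 1%N) - f 3%N * g 0%N.

Lemma symplecticC f g : symplectic g f = - symplectic f g.
Proof. by rewrite /symplectic; ring. Qed.

Lemma bihomogeneous_symplectic : bihomogeneous 1 1 symplectic.
Proof.
apply: (bihomogeneous_ext (phi := fun f g => f 0%N * g 3%N + (-3%:R * (f 1%N * g 2%N) +
   (3%:R * (f 2%N * g 1%N) + -1 * (f 3%N * g 0%N))))).
  by move=> f g; rewrite /symplectic; ring.
do ?[exact: bihomogeneous_fg | apply: bihomogeneousD | apply: bihomogeneousZ].
Qed.

(** Forms [M] of degree d + 1 and [M'] of degree d, taken modulo those vanishing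
    on [X], inject into bihomogeneous functions by
    [M(fg) + symplectic f g * M'(fg)]: exchanging [f] and [g] changes the sign of
    the second term only, so both terms vanish if the sum does. *)
Lemma hilbert_function_consecutive_le (X : 'rV[F]_7 -> Prop) d h h' :
  2%:R != 0 :> F ->
  (forall v, v != 0 -> X v -> exists f g, [/\ mutually_apolar f g,
     symplectic f g != 0 & v = sextic_vec (cubic f * cubic g)]) ->
  hilbert_function X d.+1 h -> hilbert_function X d h' ->
  (h + h' <= size (standard_bimonomials d.+1))%N.
Proof.
move=> two_neq0 XP [V [VP dimV]] [V' [V'P dimV']].
pose eval (M : {mpoly F[7]}) f g := M.@[fun i => sextic_vec (cubic f * cubic g) 0 i].
have evalC M f g : eval M g f = eval M f g by rewrite /eval mulrC.
have hE : \dim (V^C) = h by rewrite dimv_compl dimV addKn.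
have hE' : \dim (V'^C) = h' by rewrite dimv_compl dimV' addKn.
pose b (i : 'I_h) := (vbasis V^C)`_i; pose b' (j : 'I_h') := (vbasis V'^C)`_j.
pose phi (x : 'I_h + 'I_h') f g :=
  match x with inl i => eval (val (b i)) f g | inr j => symplectic f g * eval (val (b' j)) f g end.
have phi_span x : in_standard_span d.+1 (phi x).
  apply: bihomogeneous_in_standard_span; case: x => [i|j].
    exact/bihomogeneous_sextic/dhomog_is_dhomog.
  rewrite -add1n; apply: bihomogeneousM; first exact: bihomogeneous_symplectic.
  exact/bihomogeneous_sextic/dhomog_is_dhomog.
have [c cE] := choice phi_span.
pose s := standard_bimonomials d.+1.
pose T := {fg : (nat -> F) * (nat -> F) | mutually_apolar fg.1 fg.2}.
pose x0 : seq nat * seq nat := ([::], [::]).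
have -> : (h + h')%N = #|{: 'I_h + 'I_h'}| by rewrite card_sum !card_ord.
apply: (@independent_le_spanning F T _
  (fun x t => phi x (sval t).1 (sval t).2) (size s)
  (fun j t => bimonomial (nth x0 s j).1 (nth x0 s j).2 (sval t).1 (sval t).2)
  (fun x j => c x (nth x0 s j))) => [x [fg apo]|a a0].
  by rewrite /= cE // (big_nth x0) big_mkord.
pose M : dhomog 7 F d.+1 := \sum_i a (inl i) *: b i.
pose M' : dhomog 7 F d := \sum_j a (inr j) *: b' j.
have evalM f g : eval (val M) f g = \sum_i a (inl i) * eval (val (b i)) f g.
  by rewrite /eval raddf_sum raddf_sum; apply: eq_bigr => i _; rewrite /= mevalZ.
have evalM' f g : eval (val M') f g = \sum_j a (inr j) * eval (val (b' j)) f g.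
  by rewrite /eval raddf_sum raddf_sum; apply: eq_bigr => i _; rewrite /= mevalZ.
have rel f g : mutually_apolar f g ->
    eval (val M) f g + symplectic f g * eval (val M') f g = 0.
  move=> apo; have := a0 (exist _ (f, g) apo); rewrite big_sumType /= => <-.
  rewrite evalM evalM' mulr_sumr; congr (_ + _).
  by apply: eq_bigr => j _; rewrite mulrCA.
have vanish f g : mutually_apolar f g -> symplectic f g != 0 ->
    eval (val M) f g = 0 /\ eval (val M') f g = 0.
  move=> apo sym; have e1 := rel f g apo.
  have := rel g f (conj (proj2 apo) (proj1 apo)); rewrite (evalC (val M)) (evalC (val M')) symplecticC => e2.
  have M0 : eval (val M) f g = 0.
    by apply: (mulfI two_neq0); rewrite mulr0 -[RHS]addr0 -{2}e2 -e1; ring.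
  split=> //; apply: (mulfI sym); rewrite mulr0.
  by move: e1; rewrite M0 add0r.
have MV : M = 0.
  apply/eqP; rewrite -memv0 -(capv_compl V) memv_cap; apply/andP; split.
    apply/VP => v v0 /(XP v v0)[f [g [apo sym ->]]].
    exact: (proj1 (vanish f g apo sym)).
  by apply: memv_suml => i _; apply/memvZ/vbasis_mem/mem_nth; rewrite size_tuple hE.
have MV' : M' = 0.
  apply/eqP; rewrite -memv0 -(capv_compl V') memv_cap; apply/andP; split.
    apply/V'P => v v0 /(XP v v0)[f [g [apo sym ->]]].
    exact: (proj2 (vanish f g apo sym)).
  by apply: memv_suml => i _; apply/memvZ/vbasis_mem/mem_nth; rewrite size_tuple hE'.
have indep (U : vectType F) (W : {vspace U}) n (k : 'I_n -> F) : \dim W = n ->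
    \sum_i k i *: (vbasis W)`_i = 0 -> forall i, k i = 0.
  move=> Wn; case: n / Wn k => k.
  by apply/freeP/basis_free/vbasisP.
by case=> [i|j]; [exact: (indep _ _ _ _ hE MV) | exact: (indep _ _ _ _ hE' MV')].
Qed.

End UpperBound.

(** * Transversal points of a linear section and the lower bound *)

Lemma poly_eq0_of_nat (F : numFieldType) (p : {poly F}) :
  (forall n : nat, p.[n%:R] = 0) -> p = 0.
Proof.
move=> p0; apply/eqP; apply: contraT => pn0.
have := @max_poly_roots _ p [seq (n%:R : F) | n <- iota 0 (size p)] pn0.
rewrite size_map size_iota ltnn; apply.
  by apply/allP => _ /mapP[n _ ->]; rewrite /root p0.
by rewrite map_inj_uniq ?iota_uniq // => m n /eqP; rewrite eqr_nat => /eqP.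
Qed.

Lemma poly_eq0_off_zeros (F : numFieldType) (p D : {poly F}) : D != 0 ->
  (forall t, D.[t] != 0 -> p.[t] = 0) -> p = 0.
Proof.
move=> D0 pD; have : p * D = 0.
  apply: poly_eq0_of_nat => n; rewrite hornerM.
  by have [->|/pD->] := eqVneq D.[n%:R] 0; rewrite ?mulr0 ?mul0r.
by move/eqP; rewrite mulf_eq0 (negbTE D0) orbF => /eqP.
Qed.

(** Uniqueness of base [B] digits; it turns several variables into one by
    Kronecker's substitution. *)
Lemma digits_inj r B (m m' : 'I_r -> nat) :
  (forall l, m l < B)%N -> (forall l, m' l < B)%N ->
  (\sum_l m l * B ^ l = \sum_l m' l * B ^ l)%N -> forall l, m l = m' l.
Proof.
elim: r m m' => [|r IH] m m' mB mB'; first by move=> _ [].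
have E (n : 'I_r.+1 -> nat) :
    (\sum_l n l * B ^ l = (\sum_(l < r) n (lift ord0 l) * B ^ l) * B + n ord0)%N.
  rewrite big_ord_recl /= expn0 muln1 addnC big_distrl /=; congr addn.
  by apply: eq_bigr => l _; rewrite -mulnA -expnSr.
rewrite !E => eqm.
have eq0 : m ord0 = m' ord0.
  by have := congr1 (modn^~ B) eqm; rewrite !modnMDl !modn_small.
move: eqm; rewrite eq0 => /addIn /eqP; rewrite eqn_pmul2r; last first.
  exact: leq_ltn_trans (leq0n _) (mB ord0).
move/eqP/(IH _ _ (fun l => mB _) (fun l => mB' _)) => eqS l.
by case: (unliftP ord0 l) => [l'|] ->.
Qed.

Section LinearSection.
Variable F : numFieldType.

Definition along n (c : 'I_n -> {poly F}) : {mpoly F[n]} -> {poly F} :=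
  mmap polyC c.

Lemma horner_along n (c : 'I_n -> {poly F}) M t :
  (along c M).[t] = M.@[fun i => (c i).[t]].
Proof.
rewrite /along mevalE /mmap horner_sum; apply: eq_bigr => m _.
rewrite hornerM hornerC /mmap1 horner_prod; congr (_ * _).
by apply: eq_bigr => i _; rewrite horner_exp.
Qed.

Variables (n r : nat) (X : 'rV[F]_n.+1 -> Prop) (I : finType).
Variables (L : 'I_r.+1 -> {mpoly F[n.+1]}) (p : I -> 'I_n.+1 -> F).
Hypothesis L_homog : forall l, L l \is 1.-homog.
Hypothesis p_separated : forall i j, i != j ->
  exists2 l : {mpoly F[n.+1]}, l \is 1.-homog & l.@[p j] = 0 /\ l.@[p i] != 0.
(** Transversality at the point [p i]: every tangent direction [eta] of the
    target of the projection by [L] is the first-order direction of a curve in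
    the closure of [X] through [p i]. *)
Hypothesis curves : forall i (eta : 'I_r -> F), exists c : 'I_n.+1 -> {poly F},
  [/\ forall M, vanishes_on X M -> along c M = 0,
      forall k, (c k).[0] = p i k,
      (along c (L ord0)).[0] = 1 &
      forall l, (along c (L (lift ord0 l)))`_0 = 0 /\
                (along c (L (lift ord0 l)))`_1 = eta l].

(** Products of linear forms vanishing at all points but one. *)
Lemma separating_forms : exists e : I -> {mpoly F[n.+1]}, forall i,
  [/\ e i \is (#|I|.-1).-homog, (e i).@[p i] != 0 &
      forall j, j != i -> (e i).@[p j] = 0].
Proof.
suff H i : exists e : {mpoly F[n.+1]}, [/\ e \is (#|I|.-1).-homog, e.@[p i] != 0 &
      forall j, j != i -> e.@[p j] = 0] by have [e eP] := choice H; exists e.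
pose P j (l : {mpoly F[n.+1]}) := l \is 1.-homog /\
  (j != i -> l.@[p j] = 0 /\ l.@[p i] != 0).
have /choice[l lP] : forall j, exists l, P j l.
  move=> j; have [->|ji] := eqVneq j i.
    by exists (L ord0); split=> //; rewrite eqxx.
  have [|l lh lE] := @p_separated i j; first by rewrite eq_sym.
  by exists l.
exists (\prod_(j | j != i) l j); split.
- have : (#|I|.-1 = \sum_(j | j != i) 1)%N.
    by rewrite sum1_card (cardC1 i).
  move=> ->; elim/big_rec2: _ => [|j q d _ qh]; first exact: dhomog1.
  by apply: dhomogM => //; have [] := lP j.
- rewrite rmorph_prod; apply/prodf_neq0 => j ji.
  by have [_ /(_ ji)[]] := lP j.
- move=> j ji; rewrite rmorph_prod (bigD1 j) //=.
  by have [_ /(_ ji)[-> _]] := lP j; rewrite mul0r.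
Qed.

(** The products of the separating forms [e i] with the monomials in the linear
    forms [L] are independent modulo the ideal.  Otherwise take in a relation the
    terms of lowest order in [L 1], ..., [L r], which all vanish at the points,
    and restrict to a curve through [p i] with direction [eta]: only [e i]
    survives at lowest order, so the lowest form of its coefficient vanishes for
    every [eta]. *)
Lemma hilbert_function_ge_section k h :
  hilbert_function X (k + #|I|.-1) h -> (#|I| * 'C(k + r, r) <= h)%N.
Proof.
move=> [V [VP dimV]]; have [e eP] := separating_forms.
pose s := compositions r.+1 k.
pose m (j : 'I_(size s)) (l : 'I_r.+1) := nth 0%N (nth [::] s j) l.
have ms (j : 'I_(size s)) : nth [::] s j \in s by rewrite mem_nth ?ltn_ord.
have mk j : (\sum_l m j l = k)%N.
  have := ms j; rewrite mem_compositions => /andP[/eqP sj /eqP <-].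
  by rewrite sumnE (big_nth 0%N) sj big_mkord.
pose u (x : I * 'I_(size s)) : {mpoly F[n.+1]} := e x.1 * \prod_l L l ^+ m x.2 l.
have uh x : u x \is (k + #|I|.-1).-homog.
  rewrite addnC; apply: dhomogM; first by have [] := eP x.1.
  rewrite -[X in X.-homog](mk x.2).
  elim/big_rec2: _ => [|l q d _ qh]; first exact: dhomog1.
  by apply: dhomogM => //; rewrite -[X in X.-homog]mul1n; apply: dhomogMn.
have <- : #|{: I * 'I_(size s)}| = (#|I| * 'C(k + r, r))%N.
  by rewrite card_prod card_ord size_compositions.
apply: (@independent_mod_le _ _ V _ (fun x => indhomog _ (u x)) h dimV) => a aV.
have aX : vanishes_on X (\sum_x a x *: u x).
  move: aV => /VP; rewrite raddf_sum /=.
  by under eq_bigr => x _ do rewrite indhomogE //.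
pose ord j := (\sum_(l < r) m j (lift ord0 l))%N.
have ordk j : (ord j <= k)%N by rewrite -(mk j) big_ord_recl leq_addl.
suff H nu : forall i j, ord j = nu -> a (i, j) = 0 by case=> i j; apply: (H (ord j)).
elim/ltn_ind: nu => nu IH i j0 j0nu.
have [_ ei0 eij] := eP i.
have key (eta : 'I_r -> F) :
    \sum_(j | ord j == nu) a (i, j) * \prod_l eta l ^+ m j (lift ord0 l) = 0.
  have [c [cX cp c0 cL]] := curves i eta.
  have factor l : exists psi, along c (L (lift ord0 l)) = 'X * psi /\ psi`_0 = eta l.
    have [e0 e1] := cL l; have /factor_theorem[psi psiE] : root (along c (L (lift ord0 l))) 0.
      by rewrite /root horner_coef0 e0.
    rewrite subr0 mulrC in psiE; exists psi; split=> //.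
    by rewrite -e1 psiE coefXM.
  have [psi psiP] := choice factor.
  have along_u x : along c (u x) = along c (e x.1) * along c (L ord0) ^+ m x.2 ord0 *
      ('X^(ord x.2) * \prod_l psi l ^+ m x.2 (lift ord0 l)).
    rewrite /along rmorphM -mulrA rmorph_prod big_ord_recl rmorphXn; congr (_ * (_ * _)).
    rewrite /ord -prodrXr -big_split; apply: eq_bigr => l _ /=.
    have [psiE _] := psiP l; rewrite /along in psiE.
    by rewrite rmorphXn /= psiE exprMn.
  have := congr1 (fun q : {poly F} => q`_nu) (cX _ aX).
  pose G i' j := (mmap polyC c (a (i', j) *: u (i', j)))`_nu.
  rewrite /along raddf_sum coef0 coef_sum /= (eq_bigr (fun x => G x.1 x.2)); last by case.
  rewrite -(pair_bigA _ G) /= /G.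
  have term i' j : (mmap polyC c (a (i', j) *: u (i', j)))`_nu =
     if (i' == i) && (ord j == nu) then (e i).@[p i] * (a (i, j) * \prod_l eta l ^+ m j (lift ord0 l)) else 0.
    rewrite mmapZ -/(along c _) mul_polyC coefZ along_u /=.
    have [lt|] := ltnP (ord j) nu.
      by rewrite (IH _ lt) // mul0r (ltn_eqF lt) andbF.
    rewrite leq_eqVlt => /orP[/eqP <-|lt]; last first.
      by rewrite mulrCA coefXnM lt mulr0 (gtn_eqF lt) andbF.
    rewrite mulrCA coefXnM ltnn subnn !coef0M eqxx andbT.
    rewrite -[(along c (e i'))`_0]horner_coef0 horner_along.
    rewrite -[X in _ * X * _]horner_coef0 horner_exp c0 expr1n mulr1.
    have -> : (e i').@[fun k0 => (c k0).[0]] = (e i').@[p i].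
      by apply: meval_eq => k0; rewrite cp.
    have -> : (\prod_l psi l ^+ m j (lift ord0 l))`_0 = \prod_l eta l ^+ m j (lift ord0 l).
      rewrite -horner_coef0 horner_prod; apply: eq_bigr => l _.
      by rewrite horner_exp horner_coef0; have [_ ->] := psiP l.
    have [->|i'i] := eqVneq i' i; first by rewrite mulrCA.
    by have [_ _ ->] := eP i'; rewrite ?mul0r ?mulr0 // eq_sym.
  under eq_bigr => i' _ do under eq_bigr => j _ do rewrite term.
  rewrite (bigD1 i) //= [X in _ + X]big1 => [|i' /negbTE i'i]; last first.
    by rewrite i'i big1.
  rewrite addr0 eqxx /= -big_mkcond /= -mulr_sumr => /eqP.
  by rewrite mulf_eq0 (negbTE ei0) /= => /eqP.
pose B := k.+1.
pose code j := (\sum_(l < r) m j (lift ord0 l) * B ^ l)%N.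
have code_inj j : code j = code j0 -> ord j = nu -> j = j0.
  move=> cj jnu.
  have ltB j' l : (m j' (lift ord0 l) < B)%N.
    rewrite ltnS; apply: leq_trans (ordk j').
    by rewrite /ord (bigD1 l) //= leq_addr.
  have eql := digits_inj (ltB j) (ltB j0) cj.
  have eq0 : m j ord0 = m j0 ord0.
    have := mk j; rewrite -(mk j0) !big_ord_recl.
    by rewrite -!/(ord _) jnu j0nu => /addIn.
  apply/val_inj/eqP; rewrite -(nth_uniq [::] (ltn_ord j) (ltn_ord j0)) ?uniq_compositions //.
  have := ms j; have := ms j0; rewrite !mem_compositions => /andP[/eqP sj0 _] /andP[/eqP sj _].
  apply/eqP/(@eq_from_nth _ 0%N); rewrite sj ?sj0 // => l lr.
  have : m j (Ordinal lr) = m j0 (Ordinal lr) by case: (unliftP ord0 (Ordinal lr)) => [l'|] ->.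
  by [].
(* Kronecker's substitution eta_l = t^(B^l) separates the monomials because their
   exponents are smaller than B. *)
pose q : {poly F} := \sum_(j | ord j == nu) a (i, j) *: 'X^(code j).
have q0 : q = 0.
  apply: poly_eq0_of_nat => t; rewrite horner_sum.
  rewrite -[RHS](key (fun l => t%:R ^+ (B ^ l))); apply: eq_bigr => j _.
  rewrite hornerZ hornerXn /code -prodrXr; congr (_ * _); apply: eq_bigr => l _.
  by rewrite -exprM mulnC.
have := congr1 (fun q : {poly F} => q`_(code j0)) q0.
rewrite coef0 coef_sum (bigD1 j0) ?j0nu //= coefZ coefXn eqxx mulr1 big1 ?addr0 //.
move=> j /andP[/eqP jnu jj0]; rewrite coefZ coefXn.
case: eqP => [ej|_]; last by rewrite mulr0.
by case/eqP: jj0; apply: code_inj.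
Qed.

End LinearSection.

(** * Sextuples as products of two cubics of a pencil *)

Section Dehomogenization.
Variable F : fieldType.

Definition dehomogenize : {mpoly F[2]} -> {poly F} :=
  mmap polyC (fun i : 'I_2 => if i == 0 then 1 else 'X).

(** Setting x1 = 1 and x2 = X loses nothing on homogeneous forms. *)
Lemma coef_dehomogenize d (f : {mpoly F[2]}) i : (i <= d)%N -> f \is d.-homog ->
  f@_(U_(0%R) *+ (d - i) + U_(1%R) *+ i)%MM = (dehomogenize f)`_i.
Proof.
move=> lid fh; set m0 := (_ + _)%MM.
(* [m0] is the only monomial of degree [d] in which x2 has exponent [i]. *)
have m0E : m0 0 = (d - i)%N /\ m0 1 = i.
  by rewrite /m0 !mnmDE !mulmnE !mnm1E /= mul1n mul0n addn0 mul1n.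
have monoE (m : 'X_{1..2}) : mmap1 (fun i : 'I_2 => if i == 0 then 1 else 'X : {poly F}) m = 'X^(m 1).
  rewrite /mmap1 !big_ord_recl big_ord0 /= expr1n mul1r mulr1.
  by congr ('X^(m _)); apply: val_inj.
rewrite /dehomogenize /mmap coef_sum.
have unique m : m \in msupp f -> m 1 = i -> m = m0.
  move=> /(dhomog_mf fh); rewrite /= mdegE !big_ord_recl big_ord0 => dm m1.
  have m1' : m (lift ord0 ord0) = i by rewrite -m1; congr (m _); apply: val_inj.
  apply/mnmP => j; case: (unliftP 0 j) => [k|] ->.
    rewrite (ord1 k) m1' (_ : lift 0 0 = 1 :> 'I_2) ?(proj2 m0E) //; exact: val_inj.
  rewrite (proj1 m0E) -dm /= -/(_ + _)%N m1' addn0 addnK //.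
have [m0f|m0f] := boolP (m0 \in msupp f).
  rewrite (bigD1_seq m0) ?msupp_uniq //= big_seq_cond big1 ?addr0.
    by rewrite mul_polyC coefZ monoE coefXn (proj2 m0E) eqxx mulr1.
  move=> m /andP[mf mm0]; rewrite mul_polyC coefZ monoE coefXn.
  by case: eqP => [/esym/(unique _ mf) mE|_]; [rewrite mE eqxx in mm0 | rewrite mulr0].
rewrite (memN_msupp_eq0 m0f) big_seq big1 // => m mf.
rewrite mul_polyC coefZ monoE coefXn.
by case: eqP => [/esym/(unique _ mf) mE|_]; [rewrite mE in mf; rewrite mf in m0f | rewrite mulr0].
Qed.

(** A multiple of the linear form with root [z], in the coordinates x, y; for
    [x = 1], [y = X] this is the dehomogenised factor of the form of a
    sextuple. *)
Definition point_form (z : P1 F) (x y : {poly F}) : {poly F} :=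
  match z with Some w => x - w *: y | None => y end.

Lemma sextic_coords_form_of (A : {fset P1 F}) : #|` A| = 6%N ->
  sextic_coords (form_of A) = sextic_vec (\prod_(z <- A) point_form z 1 'X).
Proof.
move=> cardA; apply/rowP => i; rewrite !mxE.
have fh : form_of A \is 6.-homog.
  rewrite /form_of -cardA -sum1_size.
  elim/big_rec2: _ => [|z q d _ qh]; first exact: dhomog1.
  apply: dhomogM => //; case: z => [w|] /=; last by rewrite dhomogX /= mdeg1.
  apply: rpredB; last apply: rpredZ; by rewrite dhomogX /= mdeg1.
rewrite (@coef_dehomogenize 6) //; last by have := ltn_ord i; lia.
suff -> : dehomogenize (form_of A) = \prod_(z <- A) point_form z 1 'X by [].
rewrite /form_of /dehomogenize rmorph_prod; apply: eq_bigr => z _.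
case: z => [w|] /=; last by rewrite mmapX mmap1U.
by rewrite mmapB mmapZ !mmapX !mmap1U /= mul_polyC.
Qed.
End Dehomogenization.

Section Mobius.
Variable F : fieldType.
Variables a b c d : F.
Hypothesis det_neq0 : a * d - b * c != 0.

(** A linear substitution moves roots by the inverse homography. *)
Lemma point_form_mobius z : exists2 k : F, k != 0 &
  point_form (mobius a b c d z) (a%:P + b *: 'X) (c%:P + d *: 'X) =
  k *: point_form z 1 'X.
Proof.
case: z => [x|] /=.
  have [den0|den] := eqVneq (c * x + d) 0.
    have dE : d = - (c * x) by apply/eqP; rewrite -addr_eq0 addrC den0.
    exists c; first by apply: contraNneq det_neq0 => c0; rewrite dE c0; apply/eqP; ring.
    by rewrite /= dE -!mul_polyC rmorphN rmorphM /=; ring.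
  exists ((a * d - b * c) / (c * x + d)); first by rewrite mulf_neq0 ?invr_eq0.
  apply/polyP => i; rewrite !(coefD, coefN, coefZ, coefC, coefX).
  by case: i => [|[|i]] /=; field.
have [c0|c0] := eqVneq c 0.
  exists d; first by apply: contraNneq det_neq0 => d0; rewrite d0 c0; apply/eqP; ring.
  by rewrite /= c0 add0r.
exists ((b * c - a * d) / c); first by rewrite mulf_neq0 ?invr_eq0 // -oppr_eq0 opprB.
apply/polyP => i; rewrite /= !(coefD, coefN, coefZ, coefC, coefX).
by case: i => [|[|i]] /=; field.
Qed.

Lemma mobiusK : cancel (mobius a b c d) (mobius d (- b) (- c) a).
Proof.
case=> [x|] /=.
  have [den0|den] /= := eqVneq (c * x + d) 0.
    have dE : d = - (c * x) by apply/eqP; rewrite -addr_eq0 addrC den0.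
    have c0 : c != 0 by apply: contraNneq det_neq0 => c0; rewrite dE c0; apply/eqP; ring.
    by rewrite oppr_eq0 (negbTE c0) dE /affine; congr Some; field; rewrite oppr_eq0.
  have num : - c * ((a * x + b) / (c * x + d)) + a = (a * d - b * c) / (c * x + d) by field.
  rewrite num mulf_eq0 invr_eq0 (negbTE det_neq0) (negbTE den) /=.
  by rewrite /affine; congr Some; field; rewrite det_neq0 den.
have [c0|c0] /= := eqVneq c 0; first by rewrite c0 oppr0 eqxx.
rewrite (_ : - c * (a / c) + a = 0) ?eqxx //; by field.
Qed.

Lemma mobius_inj : injective (mobius a b c d).
Proof. exact: can_inj mobiusK. Qed.

(** Equivalent sets of points have forms that differ by a linear substitution
    and a scalar. *)
Lemma prod_point_form_mobius (A : {fset P1 F}) : exists2 k : F, k != 0 &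
  \prod_(z <- [fset mobius a b c d z | z in A]%fset)
     point_form z (a%:P + b *: 'X) (c%:P + d *: 'X) =
  k *: \prod_(z <- A) point_form z 1 'X.
Proof.
have -> : \prod_(z <- [fset mobius a b c d z | z in A]%fset)
     point_form z (a%:P + b *: 'X) (c%:P + d *: 'X) =
   \prod_(z <- A) point_form (mobius a b c d z) (a%:P + b *: 'X) (c%:P + d *: 'X).
  by rewrite big_imfset //= => x y _ _; apply: mobius_inj.
elim: (enum_fset A) => [|z s [k k0 IH]].
  by exists 1; rewrite ?oner_neq0 // !big_nil scale1r.
have [k' k'0 zE] := point_form_mobius z.
exists (k' * k); first by rewrite mulf_neq0.
by rewrite !big_cons IH zE -scalerAl -scalerAr scalerA.
Qed.

End Mobius.

Section StandardSextuple.
Variable F : fieldType.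

Definition standard_seq (p : P1 F) : seq (P1 F) :=
  [:: affine 0; affine 1; infty F; p; mobius 1 (-1) 1 0 p; mobius 0 1 (-1) 1 p].

Lemma standard_sextupleE p :
  standard_sextuple p = [fset z in standard_seq p]%fset.
Proof. by apply/fsetP => z; rewrite !inE -!orbA orbF. Qed.

Lemma perm_standard_sextuple p : perm_eq (standard_sextuple p) (undup (standard_seq p)).
Proof.
apply: uniq_perm; rewrite ?fset_uniq ?undup_uniq // => z.
rewrite mem_undup; transitivity (z \in standard_sextuple p); first by [].
by rewrite standard_sextupleE !inE orbF.
Qed.

Lemma card_standard_sextuple p :
  (#|` standard_sextuple p| == 6%N) = uniq (standard_seq p).
Proof.
rewrite (perm_size (perm_standard_sextuple p)).
apply/idP/idP => [/eqP sz|/undup_id->//].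
by rewrite -[uniq _]negbK -ltn_size_undup sz.
Qed.

Lemma prod_standard_sextuple (p : F) x y : p != 0 -> 1 - p != 0 ->
  uniq (standard_seq (Some p)) ->
  \prod_(z <- standard_sextuple (Some p)) point_form z x y =
     (x * y * (x - y)) *
     ((x - p *: y) * (x - ((p - 1) / p) *: y) * (x - (1 - p)^-1 *: y)).
Proof.
move=> p0 p1 up; rewrite (perm_big _ (perm_standard_sextuple (Some p))).
rewrite undup_id // !big_cons big_nil /= !mul1r !mul0r !addr0 (negbTE p0) /=.
rewrite (_ : -1 * p + 1 = 1 - p) ?(negbTE p1) /=; last by ring.
rewrite scale0r scale1r add0r mul1r; ring.
Qed.

Lemma standard_parameter (p : P1 F) : uniq (standard_seq p) ->
  exists p0 : F, [/\ p = Some p0, p0 != 0 & 1 - p0 != 0].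
Proof.
case: p => [p|]; last by rewrite /standard_seq /infty /= !inE !andbF.
rewrite /standard_seq /affine /= !inE => up; exists p; split=> //.
  by apply: contraTneq up => ->; rewrite eqxx ?orbT ?andbF.
by apply: contraTneq up => /eqP; rewrite subr_eq0 => /eqP <-; rewrite eqxx ?orbT ?andbF.
Qed.

End StandardSextuple.

Section LocusToCubics.
Variable F : numFieldType.

Lemma poly_ext (p q : {poly F}) : (forall t, p.[t] = q.[t]) -> p = q.
Proof.
move=> pq; apply/eqP; rewrite -subr_eq0; apply/eqP/poly_eq0_of_nat => n.
by rewrite hornerD hornerN pq subrr.
Qed.

Lemma horner_cubic (f : nat -> F) t : (cubic f).[t] =
  f 0%N + 3 * f 1%N * t + 3 * f 2%N * t ^+ 2 + f 3%N * t ^+ 3.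
Proof. by rewrite horner_Poly /=; ring. Qed.

(** The cubics [l (x^2 y - x y^2) + m (x^3 - 3 x y^2 + y^3)] in the coordinates
    [x = a + b X], [y = c + d X], in binomial normalisation.  The two generators
    span the cubics invariant under [z |-> 1 / (1 - z)], whose fixed points are
    the roots of x^2 - x y + y^2. *)
Definition pencil_cubic (a b c d l m : F) (i : nat) : F :=
  nth 0 [:: l * (a ^+ 2 * c - a * c ^+ 2) + m * (a ^+ 3 - 3 * a * c ^+ 2 + c ^+ 3);
    (l * (2 * a * b * c + a ^+ 2 * d - b * c ^+ 2 - 2 * a * c * d)
      + m * 3 * (a ^+ 2 * b - b * c ^+ 2 - 2 * a * c * d + c ^+ 2 * d)) / 3;
    (l * (b ^+ 2 * c + 2 * a * b * d - 2 * b * c * d - a * d ^+ 2)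
      + m * 3 * (a * b ^+ 2 - 2 * b * c * d - a * d ^+ 2 + c * d ^+ 2)) / 3;
    l * (b ^+ 2 * d - b * d ^+ 2) + m * (b ^+ 3 - 3 * b * d ^+ 2 + d ^+ 3)] i.

Lemma cubic_pencil a b c d l m :
  let x := a%:P + b *: 'X in let y := c%:P + d *: 'X in
  cubic (pencil_cubic a b c d l m) =
  l *: (x ^+ 2 * y - x * y ^+ 2) + m *: (x ^+ 3 - 3%:R *: (x * y ^+ 2) + y ^+ 3).
Proof.
apply: poly_ext => t; rewrite horner_cubic /pencil_cubic /=.
by rewrite !(hornerD, hornerN, hornerM, horner_exp, hornerZ, hornerC, hornerX); field.
Qed.

Lemma symplectic_pencil a b c d l m l' m' :
  symplectic (pencil_cubic a b c d l m) (pencil_cubic a b c d l' m') =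
  (l * m' - l' * m) * (a * d - b * c) ^+ 3.
Proof. by rewrite /symplectic /pencil_cubic /=; field. Qed.

Lemma mutually_apolar_pencil a b c d l m l' m' :
  mutually_apolar (pencil_cubic a b c d l m) (pencil_cubic a b c d l' m').
Proof.
suff H k n k' n' : apolar_to_hessian (pencil_cubic a b c d k n) (pencil_cubic a b c d k' n').
  by split; apply: H.
by rewrite /apolar_to_hessian /hessian /pencil_cubic /=; split; field.
Qed.

End LocusToCubics.

Section Locus.
Variable F : numFieldType.

Lemma sextic_vecZ k (p : {poly F}) : sextic_vec (k *: p) = k *: sextic_vec p.
Proof. by apply/rowP => i; rewrite !mxE coefZ. Qed.

(** The form of {0, 1, oo} is x y (x - y), and the form of
    {p, (p-1)/p, 1/(1-p)} is the member of the same pencil with parameter minus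
    the sum of these three points. *)
Lemma tri_involutive_locus_pencil (v : 'rV[F]_7) : tri_involutive_locus v ->
  exists a b c d k e : F, [/\ a * d - b * c != 0, k != 0 &
    v = sextic_vec (cubic (pencil_cubic a b c d k 0) * cubic (pencil_cubic a b c d e 1))].
Proof.
case=> A [[cardA [p [a [b [c [d [det0 imA]]]]]]] [k [k0 ->]]].
have [k' k'0] := prod_point_form_mobius det0 A; rewrite imA => prodE.
have cardB : #|` standard_sextuple p| = 6%N.
  by rewrite -imA card_imfset //; apply: mobius_inj.
have up : uniq (standard_seq p) by rewrite -card_standard_sextuple cardB.
have [p0 [pE p00 p01]] := standard_parameter up.
rewrite pE prod_standard_sextuple -?pE // in prodE.
exists a, b, c, d, (k / k'), (- (p0 + (p0 - 1) / p0 + (1 - p0)^-1)).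
split; rewrite ?mulf_neq0 ?invr_eq0 //.
rewrite sextic_coords_form_of // -sextic_vecZ; congr sextic_vec.
rewrite -[LHS](scalerK k'0) [k' *: _]scalerA mulrC -scalerA -prodE scalerA mulrC.
rewrite !cubic_pencil; apply: poly_ext => t.
rewrite !(hornerD, hornerN, hornerM, horner_exp, hornerZ, hornerC, hornerX).
by field; rewrite p00 p01.
Qed.

Lemma tri_involutive_locus_cubics (v : 'rV[F]_7) : tri_involutive_locus v ->
  exists f g, [/\ mutually_apolar f g, symplectic f g != 0 &
                  v = sextic_vec (cubic f * cubic g)].
Proof.
case/tri_involutive_locus_pencil=> a [b [c [d [k [e [det0 k0 vE]]]]]].
exists (pencil_cubic a b c d k 0), (pencil_cubic a b c d e 1); split=> //.
  exact: mutually_apolar_pencil.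
by rewrite symplectic_pencil mulr1 mulr0 subr0 mulf_neq0 // expf_neq0.
Qed.

Lemma pencil_tri_involutive_locus (a b c d k p : F) :
  a * d - b * c != 0 -> k != 0 -> p != 0 -> 1 - p != 0 -> p ^+ 2 - p + 1 != 0 ->
  tri_involutive_locus (sextic_vec (k *:
    let x := a%:P + b *: 'X in let y := c%:P + d *: 'X in
    (x * y * (x - y)) *
     ((x - p *: y) * (x - ((p - 1) / p) *: y) * (x - (1 - p)^-1 *: y)))).
Proof.
move=> det0 k0 p0 p1 p2.
have det0' : d * a - - b * - c != 0 by rewrite mulrNN mulrC.
have inf_neq (x : F) : (Some x == None) = false by [].
have none_neq (x : F) : (None == Some x) = false by [].
have neq (x y z : F) : x - y = z -> z != 0 -> (Some x == Some y) = false.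
  by move=> <- xy; apply: contraNF xy => /eqP[->]; rewrite subrr.
have up : uniq (standard_seq (Some p)).
  rewrite /standard_seq /affine /infty /= !inE /= mul1r addr0 (negbTE p0).
  rewrite mulN1r [- p + 1]addrC (negbTE p1) ?mul1r mul0r add0r /affine ?inf_neq !none_neq.
  rewrite (neq 0 1 (-1)) ?oppr_eq0 ?oner_neq0 //; last by ring.
  rewrite (neq 0 p (- p)) ?oppr_eq0 //; last by ring.
  rewrite (neq 0 _ ((1 - p) / p)) ?mulf_neq0 ?invr_eq0 //; last by field.
  rewrite (neq 0 _ (- (1 - p)^-1)) ?oppr_eq0 ?invr_eq0 //; last by field.
  rewrite (neq 1 p (1 - p)) //.
  rewrite (neq 1 _ (1 / p)) ?mulf_neq0 ?invr_eq0 ?oner_neq0 //; last by field.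
  rewrite (neq 1 _ (- p / (1 - p))) ?mulf_neq0 ?oppr_eq0 ?invr_eq0 //; last by field.
  rewrite (neq p _ ((p ^+ 2 - p + 1) / p)) ?mulf_neq0 ?invr_eq0 //; last by field.
  rewrite (neq p _ (- (p ^+ 2 - p + 1) / (1 - p))) ?mulf_neq0 ?oppr_eq0 ?invr_eq0 //; last by field.
  rewrite (neq _ _ (- (p ^+ 2 - p + 1) / (p * (1 - p)))) ?mulf_neq0 ?oppr_eq0 ?invr_eq0 //.
    by field; rewrite p0 p1.
  by rewrite mulf_neq0.
have cardB : #|` standard_sextuple (Some p)| = 6%N.
  by apply/eqP; rewrite card_standard_sextuple.
pose A := [fset mobius d (- b) (- c) a z | z in standard_sextuple (Some p)]%fset.
have cardA : #|` A| = 6%N.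
  by rewrite card_imfset //; apply: mobius_inj.
have imA : [fset mobius a b c d z | z in A]%fset = standard_sextuple (Some p).
  have K := mobiusK det0'; rewrite !opprK in K.
  apply/fsetP => z; apply/imfsetP/idP => [[w /imfsetP[y yB ->] ->]|zB]; first by rewrite K.
  by exists (mobius d (- b) (- c) a z); [apply/imfsetP; exists z | rewrite K].
have [k' k'0 prodE] := prod_point_form_mobius det0 A.
exists A; split; first by split=> //; exists (Some p), a, b, c, d.
exists (k * k'); split; first by rewrite mulf_neq0.
rewrite sextic_coords_form_of // -sextic_vecZ -scalerA -prodE imA.
by rewrite prod_standard_sextuple.
Qed.

End Locus.

(** * Sextics in the square of a pencil of cubics *)

Lemma tri_involutive_locus_neq0 (F : fieldType) (v : 'rV[F]_7) :
  tri_involutive_locus v -> v != 0.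
Proof.
case=> A [[cardA _] [k [k0 ->]]]; rewrite sextic_coords_form_of //.
rewrite scaler_eq0 (negbTE k0) /=.
have size_le (s : seq (P1 F)) : (size (\prod_(z <- s) point_form z 1 'X)%R <= (size s).+1)%N.
  elim: s => [|z s IH]; first by rewrite big_nil size_poly1.
  rewrite big_cons; apply: leq_trans (size_polyMleq _ _) _.
  have szp : (size (point_form z 1 'X : {poly F}) <= 2)%N.
    case: z => [w|] /=; last by rewrite size_polyX.
    apply: leq_trans (size_polyD _ _) _; rewrite size_poly1 size_polyN geq_max /=.
    by apply: leq_trans (size_scale_leq _ _) _; rewrite size_polyX.
  by rewrite -subn1 leq_subLR; apply: leq_trans (leq_add szp IH) _; rewrite /= add2n add1n.
have : \prod_(z <- A) point_form z 1 'X != 0 :> {poly F}.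
  rewrite prodf_seq_neq0; apply/allP => z _ /=; case: z => [w|] /=; last by rewrite polyX_eq0.
  apply/eqP => /(congr1 (fun q : {poly F} => q`_0)).
  by rewrite coefB coefC coefZ coefX coef0 mulr0 subr0; apply/eqP/oner_neq0.
apply: contra_neq => v0; apply/polyP => i; rewrite coef0.
have [i7|i7] := ltnP i 7.
  by have /rowP/(_ (Ordinal i7)) := v0; rewrite !mxE.
by rewrite nth_default //; apply: leq_trans (size_le _) _; rewrite cardA.
Qed.

Section Cubes.

(** The form a u^6 + b u^3 v^3 + c v^6 with u = u1 x + u2 y and v = v1 x + v2 y,
    at x = 1, y = X; over an arbitrary ring, so that the parameters may move along
    a curve. *)
Definition cubes_sextic (S : comNzRingType) (a b c u1 u2 v1 v2 : S) : {poly S} :=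
  let u := u1%:P + u2%:P * 'X in let v := v1%:P + v2%:P * 'X in
  a%:P * u ^+ 6 + b%:P * (u ^+ 3 * v ^+ 3) + c%:P * v ^+ 6.

Lemma map_cubes_sextic (S T : comNzRingType) (f : {rmorphism S -> T}) a b c u1 u2 v1 v2 :
  map_poly f (cubes_sextic a b c u1 u2 v1 v2) =
  cubes_sextic (f a) (f b) (f c) (f u1) (f u2) (f v1) (f v2).
Proof.
by rewrite /cubes_sextic /= !(rmorphD, rmorphM, rmorphXn) /= !map_polyC !map_polyX.
Qed.

Variable C : numClosedFieldType.

(** A form vanishing on the locus vanishes identically on a curve of which all
    but finitely many points are in the locus. *)
Lemma vanishes_along (c : 'I_7 -> {poly C}) (D : {poly C}) M :
  D != 0 -> (forall t, D.[t] != 0 -> tri_involutive_locus (\row_i (c i).[t])) ->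
  vanishes_on (@tri_involutive_locus C) M -> along c M = 0.
Proof.
move=> D0 cX MX; apply: (poly_eq0_off_zeros D0) => t /cX Xt.
rewrite horner_along -[RHS](MX _ (tri_involutive_locus_neq0 Xt) Xt).
by apply: meval_eq => i; rewrite mxE.
Qed.

(** Write the form as a (u^3 - s1^3 v^3)(u^3 - s2^3 v^3).  With a primitive cube
    root of unity w, the coordinates x, y with u = x + w y and s1 v = x + w^2 y
    take the first factor to a multiple of x y (x - y); the factors
    u - w^k s2 v of the second one then have the roots p, (p-1)/p, 1/(1-p) for
    some p. *)
Lemma cubes_sextic_tri_involutive (a b c u1 u2 v1 v2 : C) :
  u1 * v2 - u2 * v1 != 0 -> a != 0 -> c != 0 -> b ^+ 2 - 4 * a * c != 0 ->
  tri_involutive_locus (sextic_vec (cubes_sextic a b c u1 u2 v1 v2)).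
Proof.
move=> uv a0 c0 disc0.
pose h := sqrtC (b ^+ 2 - 4 * a * c).
have h2 : h ^+ 2 = b ^+ 2 - 4 * a * c by apply: sqrtCK.
pose s1 := 3.-root ((- b + h) / (2 * a)); pose s2 := 3.-root ((- b - h) / (2 * a)).
have s1E : s1 ^+ 3 = (- b + h) / (2 * a) by apply: rootCK.
have s2E : s2 ^+ 3 = (- b - h) / (2 * a) by apply: rootCK.
pose w : C := (-1 + 'i * sqrtC 3) / 2.
have w2 : w ^+ 2 + w + 1 = 0.
  have e : ('i * sqrtC 3) ^+ 2 = -3 :> C by rewrite exprMn sqrCi sqrtCK mulN1r.
  rewrite /w; move: ('i * _) e => x e.
  rewrite (_ : ((-1 + x) / 2) ^+ 2 + (-1 + x) / 2 + 1 = (x ^+ 2 + 3) / 4); first by rewrite e addNr mul0r.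
  by field.
have sumE : a * (s1 ^+ 3 + s2 ^+ 3) = - b by rewrite s1E s2E; field.
have prodE : a * (s1 ^+ 3 * s2 ^+ 3) = c.
  rewrite s1E s2E (_ : a * _ = (b ^+ 2 - h ^+ 2) / (4 * a)); last by field.
  by rewrite h2; field.
have diffE : a ^+ 2 * (s1 ^+ 3 - s2 ^+ 3) ^+ 2 = b ^+ 2 - 4 * a * c.
  by rewrite s1E s2E -h2; field.
clearbody s1 s2 w h; clear h2 s1E s2E h.
have s10 : s1 != 0 by apply: contraNneq c0 => s0; rewrite -prodE s0; apply/eqP; ring.
have s20 : s2 != 0 by apply: contraNneq c0 => s0; rewrite -prodE s0; apply/eqP; ring.
pose t := s2 / s1.
have s2t : s2 = t * s1 by rewrite /t divfK.
have t3 : 1 - t ^+ 3 != 0.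
  apply: contraNneq disc0 => e; rewrite -diffE s2t.
  rewrite (_ : _ - _ = s1 ^+ 3 * (1 - t ^+ 3)); last by ring.
  by rewrite e mulr0 expr0n mulr0.
have t0 : t != 0 by rewrite mulf_neq0 ?invr_eq0.
have w3 : w ^+ 3 = 1.
  have E : w ^+ 3 - 1 = (w - 1) * (w ^+ 2 + w + 1) by ring.
  by apply/eqP; rewrite -subr_eq0 E w2 mulr0.
have w0 : w != 0 by apply: contraTneq (oner_neq0 C) => w0; rewrite -w3 w0 expr0n eqxx.
have factor3 : 1 - t ^+ 3 = (1 - t) * (1 - w * t) * (1 - w ^+ 2 * t).
  have -> : (1 - t) * (1 - w * t) * (1 - w ^+ 2 * t) =
     1 - w ^+ 3 * t ^+ 3 + (w ^+ 2 + w + 1) * (w * t ^+ 2 - t) by ring.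
  by rewrite w3 w2; ring.
have /and3P[f1 f2 f3] : [&& 1 - t != 0, 1 - w * t != 0 & 1 - w ^+ 2 * t != 0].
  by move: t3; rewrite factor3 !mulf_eq0 !negb_or -andbA.
(* The root of u - t s1 v = (1 - t) x + (w - t w^2) y. *)
pose p := (t * w ^+ 2 - w) / (1 - t).
have p0 : p != 0.
  rewrite /p mulf_neq0 ?invr_eq0 //.
  rewrite (_ : _ - _ = - w * (1 - w * t)); last by ring.
  by rewrite mulf_neq0 ?oppr_eq0.
have p1E : 1 - p = - w ^+ 2 * (1 - w ^+ 2 * t) / (1 - t).
  have -> : 1 - p = (1 + w - t * (1 + w ^+ 2)) / (1 - t) by rewrite /p; field.
  have -> : 1 + w = - w ^+ 2 by apply/eqP; rewrite -subr_eq0 opprK -[X in _ == X]w2; apply/eqP; ring.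
  have -> : 1 + w ^+ 2 = - (w ^+ 3 * w) by rewrite w3; apply/eqP; rewrite -subr_eq0 opprK -[X in _ == X]w2; apply/eqP; ring.
  by field.
have p1 : 1 - p != 0.
  by rewrite p1E !mulf_neq0 ?oppr_eq0 ?invr_eq0 ?expf_neq0.
have p2 : p ^+ 2 - p + 1 != 0.
  have -> : p ^+ 2 - p + 1 = (p + w) * (p + w ^+ 2).
    rewrite (_ : (p + w) * _ = p ^+ 2 - p + w ^+ 3 + p * (w ^+ 2 + w + 1)); last by ring.
    by rewrite w2 w3 mulr0 addr0.
  have w1 : w - 1 != 0.
    apply/eqP => /eqP; rewrite subr_eq0 => /eqP w1; move: w2; rewrite w1.
    by apply/eqP; rewrite (_ : _ + _ = 3 :> C) ?pnatr_eq0 //; ring.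
  have -> : p + w = t * w * (w - 1) / (1 - t) by rewrite /p; field.
  have -> : p + w ^+ 2 = w * (w - 1) / (1 - t) by rewrite /p; field.
  by rewrite !mulf_neq0 ?invr_eq0.
have wneq : w - w ^+ 2 != 0.
  rewrite (_ : _ - _ = - w * (w - 1)); last by ring.
  rewrite mulf_neq0 ?oppr_eq0 //.
  apply/eqP => /eqP; rewrite subr_eq0 => /eqP w1; move: w2; rewrite w1.
  by apply/eqP; rewrite (_ : _ + _ = 3 :> C) ?pnatr_eq0 //; ring.
pose y1 := (u1 - s1 * v1) / (w - w ^+ 2); pose y2 := (u2 - s1 * v2) / (w - w ^+ 2).
have det0 : (u1 - w * y1) * y2 - (u2 - w * y2) * y1 != 0.
  rewrite (_ : _ - _ = - s1 * (u1 * v2 - u2 * v1) / (w - w ^+ 2)); last by rewrite /y1 /y2; field.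
  by rewrite !mulf_neq0 ?oppr_eq0 ?invr_eq0.
have k0 : a * (3 * (w - w ^+ 2)) * (1 - t ^+ 3) != 0.
  by rewrite !mulf_neq0 ?pnatr_eq0.
have := pencil_tri_involutive_locus det0 k0 p0 p1 p2.
congr (tri_involutive_locus (sextic_vec _)); apply: poly_ext => x.
rewrite /cubes_sextic !(hornerD, hornerN, hornerM, horner_exp, hornerZ, hornerC, hornerX).
set U := u1 + u2 * x; set V := v1 + v2 * x.
set X := (u1 - w * y1) + (u2 - w * y2) * x; set Y := y1 + y2 * x.
have UE : U = X + w * Y by rewrite /U /X /Y; ring.
have VE : s1 * V = X + w ^+ 2 * Y by rewrite /V /X /Y /y1 /y2; field.
have cE : a * U ^+ 6 + b * (U ^+ 3 * V ^+ 3) + c * V ^+ 6 =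
    a * (U ^+ 3 - (s1 * V) ^+ 3) * (U ^+ 3 - (t * (s1 * V)) ^+ 3).
  rewrite -[b]opprK -sumE -prodE s2t; ring.
rewrite {}cE UE VE.
have e1 : (X + w * Y) ^+ 3 - (X + w ^+ 2 * Y) ^+ 3 = 3 * (w - w ^+ 2) * (X * Y * (X - Y)).
  have -> : (X + w * Y) ^+ 3 - (X + w ^+ 2 * Y) ^+ 3 =
    3 * (w - w ^+ 2) * X ^+ 2 * Y + 3 * (w ^+ 2 - w ^+ 3 * w) * X * Y ^+ 2 +
    (w ^+ 3 - (w ^+ 3) ^+ 2) * Y ^+ 3 by ring.
  by rewrite w3; ring.
have e2 : (X + w * Y) ^+ 3 - (t * (X + w ^+ 2 * Y)) ^+ 3 = (1 - t ^+ 3) *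
   ((X - p * Y) * (X - (p - 1) / p * Y) * (X - (1 - p)^-1 * Y)).
  have -> : (X + w * Y) ^+ 3 - (t * (X + w ^+ 2 * Y)) ^+ 3 =
     ((X + w * Y) - t * (X + w ^+ 2 * Y)) * ((X + w * Y) - w * t * (X + w ^+ 2 * Y)) *
     ((X + w * Y) - w ^+ 2 * t * (X + w ^+ 2 * Y)).
    move: (X + w * Y) (X + w ^+ 2 * Y) => P Q.
    have -> : (P - t * Q) * (P - w * t * Q) * (P - w ^+ 2 * t * Q) =
      P ^+ 3 - w ^+ 3 * (t * Q) ^+ 3 + (w ^+ 2 + w + 1) * (w * t ^+ 2 * P * Q ^+ 2 - t * P ^+ 2 * Q) by ring.
    by rewrite w3 w2; ring.
  have -> : X + w * Y - t * (X + w ^+ 2 * Y) = (1 - t) * (X - p * Y) by rewrite /p; field.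
  have -> : X + w * Y - w * t * (X + w ^+ 2 * Y) = (1 - w * t) * (X - (p - 1) / p * Y).
    rewrite -[p - 1]opprB p1E /p (_ : t * w ^+ 2 - w = - w * (1 - w * t)); last by ring.
    rewrite (_ : X + _ - _ = (1 - w * t) * X + (w - w ^+ 3 * t) * Y); last by ring.
    rewrite (_ : w - w ^+ 3 * t = w * (1 - w ^+ 2 * t)); last by ring.
    by field; rewrite f1 w0 f2.
  have -> : X + w * Y - w ^+ 2 * t * (X + w ^+ 2 * Y) =
      (1 - w ^+ 2 * t) * (X - (1 - p)^-1 * Y).
    rewrite p1E (_ : X + _ - _ = (1 - w ^+ 2 * t) * X + w * (1 - w ^+ 3 * t) * Y); last by ring.
    have wV : (w ^+ 2)^-1 = w.
      by apply: (mulfI (expf_neq0 2 w0)); rewrite mulfV ?expf_neq0 // -exprSr w3.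
    rewrite (_ : _ * (X - _) = (1 - w ^+ 2 * t) * X + (w ^+ 2)^-1 * (1 - t) * Y).
      by rewrite wV w3; ring.
    by field; rewrite f1 f3 w0.
  by rewrite factor3; ring.
by rewrite e1 e2; ring.
Qed.

End Cubes.

(** The coefficients of a P^2 + b P N + e N^2, where
      P = x^3 - 3 s x y^2 - r s y^3,   N = 3 x^2 y + 3 r x y^2 + (r^2 - s) y^3
    is the basis of the cubics apolar to the quadratic form x^2 + r x y + s y^2.
    The parameters are rational where the linear factors of the quadratic form
    would need square roots. *)
Definition apolar_coef (S : comNzRingType) (a b e r s : S) (k : nat) : S :=
  nth 0 [:: a; 3%:R * b; 9%:R * e + 3%:R * r * b - 6%:R * s * a;
    18%:R * r * e + (r ^+ 2 - 10%:R * s) * b - 2%:R * r * s * a;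
    (15%:R * r ^+ 2 - 6%:R * s) * e - 12%:R * r * s * b + 9%:R * s ^+ 2 * a;
    6%:R * r * (r ^+ 2 - s) * e + (3%:R * s ^+ 2 - 6%:R * r ^+ 2 * s) * b + 6%:R * r * s ^+ 2 * a;
    (r ^+ 2 - s) ^+ 2 * e - r * s * (r ^+ 2 - s) * b + r ^+ 2 * s ^+ 2 * a] k.

Lemma horner_apolar_coef (F : comNzRingType) (a b e r s : {poly F}) t k :
  (apolar_coef a b e r s k).[t] = apolar_coef a.[t] b.[t] e.[t] r.[t] s.[t] k.
Proof.
rewrite /apolar_coef; move: k => [|[|[|[|[|[|[|k]]]]]]] /=; rewrite ?nth_nil ?horner0 //.
all: by rewrite -?polyC_natr ?(hornerD, hornerN, hornerM, horner_exp, hornerC).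
Qed.

Section Closure.
Variable C : numClosedFieldType.
Variable M : {mpoly C[7]}.
Hypothesis MX : vanishes_on (@tri_involutive_locus C) M.

Lemma horner_cubes_sextic_coef (a b c u1 u2 v1 v2 : {poly C}) k t :
  ((cubes_sextic a b c u1 u2 v1 v2)`_k).[t] =
  (cubes_sextic a.[t] b.[t] c.[t] u1.[t] u2.[t] v1.[t] v2.[t])`_k.
Proof.
have := map_cubes_sextic (horner_eval t) a b c u1 u2 v1 v2.
by move/(congr1 (fun p : {poly C} => p`_k)); rewrite coef_map.
Qed.

(** Every choice of parameters lies on a line through the generic form
    u^6 + v^6 with u = x, v = y. *)
Lemma vanishes_cubes_sextic (a b c u1 u2 v1 v2 : C) :
  M.@[fun i : 'I_7 => (cubes_sextic a b c u1 u2 v1 v2)`_i] = 0.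
Proof.
(* The line from the given parameters, at 0, to those of u^6 + v^6, at 1. *)
pose l (x y : C) : {poly C} := x%:P + (y - x)%:P * 'X.
have l0 x y : (l x y).[0] = x by rewrite /l hornerD hornerM !hornerC hornerX mulr0 addr0.
have l1 x y : (l x y).[1] = y by rewrite /l hornerD hornerM !hornerC hornerX mulr1 addrC subrK.
pose p (i : 'I_7) := (cubes_sextic (l a 1) (l b 0) (l c 1) (l u1 1) (l u2 0) (l v1 0) (l v2 1))`_i.
pose D := (l u1 1 * l v2 1 - l u2 0 * l v1 0) * (l a 1 * l c 1 * (l b 0 ^+ 2 - 4%:R *: (l a 1 * l c 1))).
have DE t : D.[t] = ((l u1 1).[t] * (l v2 1).[t] - (l u2 0).[t] * (l v1 0).[t]) *
   ((l a 1).[t] * (l c 1).[t] * ((l b 0).[t] ^+ 2 - 4%:R * ((l a 1).[t] * (l c 1).[t]))).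
  by rewrite /D !(hornerD, hornerN, hornerM, horner_exp, hornerZ).
have D0 : D != 0.
  apply/eqP => /(congr1 (horner^~ 1)); rewrite horner0 DE !l1.
  rewrite !mulr0 !mul1r subr0 mul1r expr0n sub0r mulr1 => /eqP.
  by rewrite oppr_eq0 pnatr_eq0.
have pX t : D.[t] != 0 -> tri_involutive_locus (\row_i (p i).[t]).
  rewrite DE !mulf_eq0 !negb_or => /and3P[uv /andP[a0 c0] disc].
  have -> : \row_i (p i).[t] = sextic_vec (cubes_sextic (l a 1).[t] (l b 0).[t] (l c 1).[t]
      (l u1 1).[t] (l u2 0).[t] (l v1 0).[t] (l v2 1).[t]).
    by apply/rowP => i; rewrite !mxE /p horner_cubes_sextic_coef.
  by apply: cubes_sextic_tri_involutive; rewrite // -mulrA.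
have /(congr1 (horner^~ 0)) := vanishes_along D0 pX MX.
rewrite horner0 horner_along => E; rewrite -[RHS]E.
by apply: meval_eq => i; rewrite /p horner_cubes_sextic_coef !l0.
Qed.

(** When x^2 + r x y + s y^2 has distinct linear factors u, v, the cubics apolar
    to it are the combinations of u^3 and v^3. *)
Lemma vanishes_apolar (a b e r s : C) : r ^+ 2 - 4 * s != 0 ->
  M.@[fun i : 'I_7 => apolar_coef a b e r s i] = 0.
Proof.
move=> disc0; pose h := sqrtC (r ^+ 2 - 4 * s).
have h2 : h ^+ 2 = r ^+ 2 - 4 * s by apply: sqrtCK.
have h0 : h != 0 by apply: contraNneq disc0 => h0; rewrite -h2 h0 expr0n.
pose z1 := (- r - h) / 2; pose z2 := (- r + h) / 2.
have hE : z2 - z1 = h by rewrite /z1 /z2; field.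
have rE : r = - (z1 + z2) by rewrite /z1 /z2; field.
have sE : s = z1 * z2.
  have -> : z1 * z2 = (r ^+ 2 - h ^+ 2) / 4 by rewrite /z1 /z2; field.
  by rewrite h2; field.
have z0 : z2 - z1 != 0 by rewrite hE.
clearbody z1 z2.
rewrite -[RHS](vanishes_cubes_sextic ((a * z2 ^+ 2 + b * z2 + e) / (z2 - z1) ^+ 2)
  (- (2 * a * z1 * z2 + b * (z1 + z2) + 2 * e) / (z2 - z1) ^+ 2)
  ((a * z1 ^+ 2 + b * z1 + e) / (z2 - z1) ^+ 2) 1 (- z1) 1 (- z2)).
apply: meval_eq => i.
suff -> : cubes_sextic ((a * z2 ^+ 2 + b * z2 + e) / (z2 - z1) ^+ 2)
  (- (2 * a * z1 * z2 + b * (z1 + z2) + 2 * e) / (z2 - z1) ^+ 2)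
  ((a * z1 ^+ 2 + b * z1 + e) / (z2 - z1) ^+ 2) 1 (- z1) 1 (- z2) =
  Poly [seq apolar_coef a b e r s k | k <- iota 0 7].
  by rewrite coef_Poly (nth_map 0%N) ?size_iota // nth_iota.
apply: poly_ext => t; rewrite horner_Poly /= /cubes_sextic /apolar_coef /=.
rewrite !(hornerD, hornerN, hornerM, horner_exp, hornerC, hornerX) rE sE.
by field.
Qed.

End Closure.

(** * An icosahedral plane and its sixteen points *)

Lemma coef1M (S : comNzRingType) (p q : {poly S}) :
  (p * q)`_1 = p`_0 * q`_1 + p`_1 * q`_0.
Proof. by rewrite coefM !big_ord_recl big_ord0 addr0. Qed.

(** The effect of y -> z y together with a rescaling by [l]. *)
Lemma apolar_coef_twist (S : comNzRingType) (l z a b e r s : S) k : (k < 7)%N ->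
  apolar_coef (l * a) (l * z * b) (l * z ^+ 2 * e) (z * r) (z ^+ 2 * s) k =
  l * z ^+ k * apolar_coef a b e r s k.
Proof.
by rewrite /apolar_coef; move: k => [|[|[|[|[|[|[|k]]]]]]] //= _; ring.
Qed.

Section Deformation.
Variable C : numFieldType.
Variable q : C.
Hypothesis qE : q ^+ 3 - 2 * q ^+ 2 - 2 * q + 1 = 0.

Lemma q_cases : q = -1 \/ q ^+ 2 = 3 * q - 1.
Proof.
have : (q + 1) * (q ^+ 2 - 3 * q + 1) = 0 by rewrite -qE; ring.
move/eqP; rewrite mulf_eq0 => /orP[/eqP e|/eqP e]; [left|right].
  by apply/eqP; rewrite -subr_eq0 opprK e.
by apply/eqP; rewrite -subr_eq0 -[X in _ == X]e; apply/eqP; ring.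
Qed.

(** Up to the factor 225 this is the Jacobian determinant of [deformation]
    reduced modulo the equation of [q]. *)
Lemma jacobian_neq0 : 3 * q ^+ 2 - 4 * q - 2 != 0.
Proof.
have [->|q2] := q_cases.
  by rewrite (_ : _ - _ = 5) ?pnatr_eq0 //; ring.
rewrite q2 (_ : _ - 2 = 5 * (q - 1)); last by ring.
rewrite mulf_neq0 ?pnatr_eq0 // subr_eq0; apply/eqP => q1; move: q2; rewrite q1 => /eqP.
by rewrite -subr_eq0 (_ : _ - _ = -1) ?oppr_eq0 ?oner_eq0 //; ring.
Qed.

Lemma discriminant_neq0 : q ^+ 2 + 4 != 0.
Proof.
have [->|q2] := q_cases.
  by rewrite (_ : _ + _ = 5) ?pnatr_eq0 //; ring.
rewrite q2; apply/eqP => e; have q1 : q = -1.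
  by apply: (mulfI (_ : (3 : C) != 0)); rewrite ?pnatr_eq0 //; apply/eqP; rewrite -subr_eq0 -[X in _ == X]e; apply/eqP; ring.
move: q2; rewrite q1 => /eqP; rewrite -subr_eq0 (_ : _ - _ = 5) ?pnatr_eq0 //; ring.
Qed.

Definition linear_path (x y : C) : {poly C} := x%:P + y%:P * 'X.

Lemma linear_path0 x y : (linear_path x y)`_0 = x.
Proof. by rewrite coefD coefC coef0M coefX mulr0 addr0. Qed.

Lemma linear_path1 x y : (linear_path x y)`_1 = y.
Proof. by rewrite coefD coefC coef1M !coefC coefX mulr1 mul0r addr0 add0r. Qed.

(** Transversality at the special sextics.  In the chart [apolar_coef] with
    [a = 1] the coordinate F2 of the sextic can be moved freely by [e], and the
    three functions F5 - 3 F0, F1 + 3 F6, F4 of (b, r, s) have an invertible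
    Jacobian matrix at (1, -q, -1), with entries [j11] to [j43]; the direction is
    found by Cramer's rule. *)
Lemma deformation (g1 g2 g3 g4 : C) : exists b e r s : {poly C},
  let f := apolar_coef 1 b e r s in
  [/\ [/\ b`_0 = 1, e`_0 = (q - 2) / 3, r`_0 = - q & s`_0 = -1],
      (f 5%N)`_1 - 3 * (f 0%N)`_1 = g1,
      (f 1%N)`_1 + 3 * (f 6%N)`_1 = g2,
      (f 2%N)`_1 = g3 & (f 4%N)`_1 = g4].
Proof.
pose j11 := 3 + 4 * q ^+ 2 - 2 * q ^+ 4.
pose j12 := 2 - 8 * q - 12 * q ^+ 2 + 8 * q ^+ 3.
pose j13 := -6 + 4 * q - 4 * q ^+ 2 - 4 * q ^+ 3.
pose j21 := 3 - 2 * q - q ^+ 3 + q ^+ 5.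
pose j22 := 2 + 2 * q + 3 * q ^+ 2 + 8 * q ^+ 3 - 5 * q ^+ 4.
pose j23 := 6 + 4 * q + 2 * q ^+ 2 + q ^+ 3 + 2 * q ^+ 4.
pose j41 := -10 * q + 5 * q ^+ 3.
pose j42 := 10 + 20 * q - 15 * q ^+ 2.
pose j43 := -10 + 10 * q + 10 * q ^+ 2.
pose det := j11 * (j22 * j43 - j23 * j42) - j12 * (j21 * j43 - j23 * j41) + j13 * (j21 * j42 - j22 * j41).
have det0 : det != 0.
  (* Division with remainder of the determinant by the equation of q. *)
  have -> : det = 225 * (3 * q ^+ 2 - 4 * q - 2) + (q ^+ 3 - 2 * q ^+ 2 - 2 * q + 1) *
      (90 - 100 * q - 85 * q ^+ 2 - 20 * q ^+ 3 - 20 * q ^+ 4 + 20 * q ^+ 5 - 10 * q ^+ 6).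
    by rewrite /det /j11 /j12 /j13 /j21 /j22 /j23 /j41 /j42 /j43; ring.
  by rewrite qE mul0r addr0 mulf_neq0 ?pnatr_eq0 ?jacobian_neq0.
pose ph := g3 / 9.
pose h1 := g1 + 6 * q * (q ^+ 2 + 1) * ph.
pose h2 := g2 - 3 * (q ^+ 2 + 1) ^+ 2 * ph.
pose h4 := g4 - (15 * q ^+ 2 + 6) * ph.
pose be := (h1 * (j22 * j43 - j23 * j42) - j12 * (h2 * j43 - j23 * h4) + j13 * (h2 * j42 - j22 * h4)) / det.
pose rh := (j11 * (h2 * j43 - j23 * h4) - h1 * (j21 * j43 - j23 * j41) + j13 * (j21 * h4 - h2 * j41)) / det.
pose sg := (j11 * (j22 * h4 - h2 * j42) - j12 * (j21 * h4 - h2 * j41) + h1 * (j21 * j42 - j22 * j41)) / det.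
have e1 : j11 * be + j12 * rh + j13 * sg = h1.
  by rewrite /be /rh /sg; move: det0; rewrite /det; clear; move: j11 j12 j13 j21 j22 j23 j41 j42 j43 h1 h2 h4 => *; field.
have e2 : j21 * be + j22 * rh + j23 * sg = h2.
  by rewrite /be /rh /sg; move: det0; rewrite /det; clear; move: j11 j12 j13 j21 j22 j23 j41 j42 j43 h1 h2 h4 => *; field.
have e4 : j41 * be + j42 * rh + j43 * sg = h4.
  by rewrite /be /rh /sg; move: det0; rewrite /det; clear; move: j11 j12 j13 j21 j22 j23 j41 j42 j43 h1 h2 h4 => *; field.
pose b := linear_path 1 be; pose r := linear_path (- q) rh; pose s := linear_path (-1) sg.
have [b0 b1] : b`_0 = 1 /\ b`_1 = be by rewrite linear_path0 linear_path1.
have [r0 r1] : r`_0 = - q /\ r`_1 = rh by rewrite linear_path0 linear_path1.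
have [s0 s1] : s`_0 = -1 /\ s`_1 = sg by rewrite linear_path0 linear_path1.
clearbody b r s.
pose e := 3^-1%:P * ((2 : C)%:P * s - r * b) + ph%:P * 'X.
have e0 : e`_0 = (q - 2) / 3.
  by rewrite /e !(coefD, coefN, coef0M, coefC, coefX) /= s0 r0 b0; field.
have e1' : e`_1 = (2 * sg + q * be - rh) / 3 + ph.
  by rewrite /e !(coefD, coefN, coef0M, coef1M, coefC, coefX) /= s0 r0 b0 b1 s1 r1; field.
clearbody e.
exists b, e, r, s; split=> //=; rewrite /apolar_coef /= ?expr2 -?polyC_natr;
  rewrite !(coefD, coefN, coef0M, coef1M, coefC, coefX) /= ?(b0, b1, e0, e1', r0, r1, s0, s1).
- have -> : g1 = j11 * be + j12 * rh + j13 * sg - 6 * q * (q ^+ 2 + 1) * ph.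
    by rewrite e1 /h1; ring.
  by rewrite /j11 /j12 /j13; field.
- have -> : g2 = j21 * be + j22 * rh + j23 * sg + 3 * (q ^+ 2 + 1) ^+ 2 * ph.
    by rewrite e2 /h2; ring.
  by rewrite /j21 /j22 /j23; field.
- by rewrite /ph; field.
- have -> : g4 = j41 * be + j42 * rh + j43 * sg + (15 * q ^+ 2 + 6) * ph.
    by rewrite e4 /h4; ring.
  by rewrite /j41 /j42 /j43; field.
Qed.

End Deformation.

Section SixteenPoints.
Variable C : numClosedFieldType.

Lemma fifth_roots : exists z : 'I_5 -> C, injective z /\ forall i, z i ^+ 5 = 1.
Proof.
pose p : {poly C} := \sum_(i < 5) 'X^i.
have sz : size p != 1%N.
  have p4 : p`_4 = 1 by rewrite coef_sum !big_ord_recl big_ord0 /= !coefXn /= !add0r addr0.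
  apply/eqP => sz1; have := oner_neq0 C; rewrite -p4 nth_default ?eqxx //.
  by rewrite sz1.
have /closed_rootP[w /rootP w0] := sz.
have w1 : w != 1.
  apply/eqP => w1; move: w0; rewrite w1 horner_sum.
  under eq_bigr do rewrite hornerXn expr1n.
  by rewrite sumr_const card_ord => /eqP; rewrite pnatr_eq0.
have w5 : w ^+ 5 = 1.
  apply/eqP; rewrite -subr_eq0.
  move: w0; rewrite horner_sum; under eq_bigr do rewrite hornerXn.
  by rewrite subrX1 => ->; rewrite mulr0.
have prim : 5.-primitive_root w.
  have [//|m prim_m m5] := prim_order_exists (n := 5) _ w5.
  have : m \in divisors 5 by rewrite -dvdn_divisors.
  rewrite (_ : divisors 5 = [:: 1; 5]%N) // !inE => /orP[/eqP m1|/eqP <-] //.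
  by have := prim_expr_order prim_m; rewrite m1 expr1 => e; rewrite e eqxx in w1.
exists (fun i => w ^+ i); split=> [i j /eqP|i].
  rewrite (eq_prim_root_expr prim) !modn_small ?ltn_ord // => /eqP ij.
  exact: val_inj.
by rewrite -exprM mulnC exprM w5 expr1n.
Qed.

Lemma cubic_roots : exists q : 'I_3 -> C, injective q /\
  forall i, q i ^+ 3 - 2 * q i ^+ 2 - 2 * q i + 1 = 0.
Proof.
pose h : C := sqrtC 5.
have h2 : h ^+ 2 = 5 by apply: sqrtCK.
have h0 : h != 0 by apply/eqP => h0; move: h2; rewrite h0 expr0n => /eqP; rewrite eq_sym pnatr_eq0.
have hq (e : C) : e ^+ 2 = 5 -> ((3 + e) / 2) ^+ 3 - 2 * ((3 + e) / 2) ^+ 2 - 2 * ((3 + e) / 2) + 1 = 0.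
  move=> e2; have -> : ((3 + e) / 2) ^+ 3 - 2 * ((3 + e) / 2) ^+ 2 - 2 * ((3 + e) / 2) + 1 =
    (e ^+ 2 - 5) * ((e + 5) / 8) by field.
  by rewrite e2 subrr mul0r.
have hm1 (e : C) : e ^+ 2 = 5 -> (3 + e) / 2 != -1.
  move=> e2; apply/eqP => e1; have eE : e = -5.
    have -> : e = 2 * ((3 + e) / 2) - 3 by field.
    by rewrite e1; ring.
  move/eqP: e2; rewrite eE -subr_eq0 (_ : _ - _ = 20) ?pnatr_eq0 //; ring.
have hN2 : (- h) ^+ 2 = 5 by rewrite sqrrN.
have hpm : (3 + h) / 2 != (3 + - h) / 2.
  by rewrite -subr_eq0 (_ : _ - _ = h) //; field.
exists (fun i : 'I_3 => nth 0 [:: -1; (3 + h) / 2; (3 + - h) / 2] i); split.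
  move=> [[|[|[|i]]] Hi] [[|[|[|j]]] Hj] //= e; apply: val_inj => //=; exfalso; move/eqP: e; apply/negP => //.
  - by rewrite eq_sym hm1.
  - by rewrite eq_sym hm1.
  - by rewrite hm1.
  - by rewrite hm1.
  - by rewrite eq_sym.
by move=> [[|[|[|i]]] Hi] //=; [ring | apply: hq | apply: hq].
Qed.

Lemma q_neq0 (q : C) : q ^+ 3 - 2 * q ^+ 2 - 2 * q + 1 = 0 -> q != 0.
Proof.
move=> qE; apply/eqP => q0; move: qE; rewrite q0 => /eqP.
by rewrite (_ : _ + 1 = 1) ?oner_eq0 //; ring.
Qed.

(** For x^2 - q x y - y^2 the combination P^2 + P N + (q - 2)/3 N^2 is
    x^6 + 3 x^5 y + (5/q) x^3 y^3 + 3 x y^5 - y^6 exactly when [q] satisfies the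
    cubic equation. *)
Lemma special_sextic_coefs (q : C) : q ^+ 3 - 2 * q ^+ 2 - 2 * q + 1 = 0 ->
  [/\ apolar_coef 1 1 ((q - 2) / 3) (- q) (-1) 2 = 0,
      apolar_coef 1 1 ((q - 2) / 3) (- q) (-1) 3 = 5 / q,
      apolar_coef 1 1 ((q - 2) / 3) (- q) (-1) 4 = 0,
      apolar_coef 1 1 ((q - 2) / 3) (- q) (-1) 5 = 3 &
      apolar_coef 1 1 ((q - 2) / 3) (- q) (-1) 6 = -1].
Proof.
move=> qE; have q0 := q_neq0 qE.
have via (x k : C) : x = (q ^+ 3 - 2 * q ^+ 2 - 2 * q + 1) * k -> x = 0 by rewrite qE mul0r.
rewrite /apolar_coef /=; split; apply/eqP; rewrite -subr_eq0; apply/eqP.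
- by field.
- by apply: (via _ (-5 / q)); field.
- by apply: (via _ 5); field.
- by apply: (via _ (-2 * q)); field.
- by apply: (via _ ((q ^+ 2 + 1) / 3)); field.
Qed.

Section Curves.

Definition coordinate (k : nat) : {mpoly C[7]} := 'X_(inord k).

(** The last four forms cut out the icosahedral plane; the first one is nonzero
    at all sixteen points. *)
Definition section_form (l : 'I_5) : {mpoly C[7]} :=
  nth 0 [:: coordinate 3; coordinate 5 - 3%:R *: coordinate 0;
    coordinate 1 + 3%:R *: coordinate 6; coordinate 2; coordinate 4] l.

Lemma coordinate_homog k : coordinate k \is 1.-homog.
Proof. by rewrite dhomogX /= mdeg1. Qed.

Lemma section_form_homog l : section_form l \is 1.-homog.
Proof.
have H := coordinate_homog.
by case: l => [[|[|[|[|[|l]]]]] Hl] //; rewrite /section_form /= ?rpredB ?rpredD ?rpredZ //.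
Qed.

Lemma along_coordinate (c : 'I_7 -> {poly C}) k : along c (coordinate k) = c (inord k).
Proof. by rewrite /along mmapX mmap1U. Qed.

Lemma along_section_form (f : nat -> {poly C}) (l : 'I_5) :
  along (fun i : 'I_7 => f i) (section_form l) =
  nth 0 [:: f 3%N; f 5%N - 3%:P * f 0%N; f 1%N + 3%:P * f 6%N; f 2%N; f 4%N] l.
Proof.
have X k : (k < 7)%N -> mmap polyC (fun i : 'I_7 => f i) (coordinate k) = f k.
  by move=> k7; rewrite -/(along _ _) along_coordinate inordK.
case: l => [[|[|[|[|[|l]]]]] Hl] //; rewrite /section_form /along /= ?X //.
  by rewrite mmapB mmapZ !X.
by rewrite mmapD mmapZ !X.
Qed.

(** [Some (z, q)] is the image of the sextic of [q] under y -> z y and [None] is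
    x^3 y^3, both normalised so that the coefficient of x^3 y^3 is 1. *)
Definition special_point (x : option (C * C)) (k : nat) : C :=
  if x is Some (z, q) then
    q / (5 * z ^+ 3) * z ^+ k * apolar_coef 1 1 ((q - 2) / 3) (- q) (-1) k
  else (k == 3%N)%:R.

(** The substitution y -> z y multiplies the coefficient of x^(6-k) y^k by z^k and
    preserves the plane since z^5 = 1, so the deformation at z = 1 can be
    transported. *)
Lemma curves_at_special_sextic (z q : C) (eta : 'I_4 -> C) :
  z ^+ 5 = 1 -> q ^+ 3 - 2 * q ^+ 2 - 2 * q + 1 = 0 ->
  exists c : 'I_7 -> {poly C},
  [/\ forall M, vanishes_on (@tri_involutive_locus C) M -> along c M = 0,
      forall k : 'I_7, (c k).[0] = special_point (Some (z, q)) k,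
      (along c (section_form ord0)).[0] = 1 &
      forall l, (along c (section_form (lift ord0 l)))`_0 = 0 /\
                (along c (section_form (lift ord0 l)))`_1 = eta l].
Proof.
move=> z5 qE; have q0 := q_neq0 qE.
have z0 : z != 0 by apply: contraTneq (oner_neq0 C) => z0; rewrite -z5 z0 expr0n eqxx.
(* This makes the coefficient of x^3 y^3 equal to 1. *)
pose la := q / (5 * z ^+ 3).
have la0 : la != 0 by rewrite !mulf_neq0 ?invr_eq0 ?mulf_neq0 ?pnatr_eq0 ?expf_neq0.
pose et k := eta (inord k).
have [b [e [r [s]]]] := deformation qE (et 0%N / la) (et 1%N / (la * z)) (et 2%N / (la * z ^+ 2))
   (et 3%N / (la * z ^+ 4)).
move=> /= [[b0 e0 r0 s0] d1 d2 d3 d4].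
pose f := apolar_coef 1 b e r s; rewrite -/f in d1 d2 d3 d4.
have f0 k : (f k)`_0 = apolar_coef 1 1 ((q - 2) / 3) (- q) (-1) k.
  by rewrite /f -horner_coef0 horner_apolar_coef hornerC !horner_coef0 b0 e0 r0 s0.
have [v2 v3 v4 v5 v6] := special_sextic_coefs qE.
pose g k : {poly C} := la%:P * z%:P ^+ k * f k.
have gE k : (k < 7)%N -> g k = apolar_coef (la%:P * 1) (la%:P * z%:P * b)
     (la%:P * z%:P ^+ 2 * e) (z%:P * r) (z%:P ^+ 2 * s) k.
  by move=> k7; rewrite apolar_coef_twist.
have g_coef k i : (g k)`_i = la * z ^+ k * (f k)`_i.
  by rewrite /g -rmorphXn -rmorphM mul_polyC coefZ.
clearbody f.
exists (fun k => g k); split.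
- move=> M MX; pose D := (z%:P * r) ^+ 2 - 4%:P * (z%:P ^+ 2 * s).
  have D0 : D != 0.
    apply/eqP => /(congr1 (horner^~ 0)).
    rewrite horner0 /D !(hornerD, hornerN, hornerM, horner_exp, hornerC) !horner_coef0 r0 s0.
    rewrite (_ : _ - _ = z ^+ 2 * (q ^+ 2 + 4)); last by ring.
    by apply/eqP; rewrite mulf_neq0 ?expf_neq0 ?discriminant_neq0.
  apply: (poly_eq0_off_zeros D0) => t Dt; rewrite horner_along.
  rewrite -[RHS](vanishes_apolar MX (la * 1) (la * z * b.[t]) (la * z ^+ 2 * e.[t])
     (r := z * r.[t]) (s := z ^+ 2 * s.[t])); last first.
    by move: Dt; rewrite /D !(hornerD, hornerN, hornerM, horner_exp, hornerC).
  apply: meval_eq => k; rewrite gE // horner_apolar_coef.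
  by rewrite !(hornerM, horner_exp, hornerC).
- by move=> k; rewrite horner_coef0 g_coef f0.
- rewrite along_section_form /= horner_coef0 g_coef f0 v3 /la.
  by field; rewrite q0 z0.
move=> l; rewrite along_section_form.
have ett k (Hk : (k < 4)%N) : et k = eta (Ordinal Hk) by congr eta; apply: val_inj; rewrite /= inordK.
have z6 : z ^+ 6 = z by rewrite exprSr z5 mul1r.
case: l => [[|[|[|[|l]]]] Hl] //=; rewrite -(ett _ Hl).
- rewrite !(coefB, mul_polyC, coefZ, g_coef, f0) v5 z5 expr0 {1}/apolar_coef /=; split; first by ring.
  have -> : et 0%N = la * (et 0%N / la) by field.
  by rewrite -d1; ring.
- rewrite !(coefD, mul_polyC, coefZ, g_coef, f0) v6 z6 {1}/apolar_coef /=; split; first by ring.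
  have -> : et 1%N = la * z * (et 1%N / (la * z)) by field; rewrite la0 z0.
  by rewrite -d2; ring.
- rewrite !(g_coef, f0) v2 mulr0; split=> //.
  by rewrite d3; field; rewrite la0 z0.
- rewrite !(g_coef, f0) v4 mulr0; split=> //.
  by rewrite d4; field; rewrite la0 z0.
Qed.

(** Near x^3 y^3, moving u = x and v = y changes the coefficients of x^2 y^4 and
    x^4 y^2, and adding multiples of u^6 and v^6 changes those of x^6 and y^6. *)
Lemma curves_at_cube (eta : 'I_4 -> C) :
  exists c : 'I_7 -> {poly C},
  [/\ forall M, vanishes_on (@tri_involutive_locus C) M -> along c M = 0,
      forall k : 'I_7, (c k).[0] = special_point None k,
      (along c (section_form ord0)).[0] = 1 &
      forall l, (along c (section_form (lift ord0 l)))`_0 = 0 /\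
                (along c (section_form (lift ord0 l)))`_1 = eta l].
Proof.
pose et k := eta (inord k).
pose path x : {poly C} := x%:P * 'X.
have path0 x : (path x)`_0 = 0 by rewrite /path coef0M coefX mulr0.
have path1 x : (path x)`_1 = x by rewrite /path coef1M !coefC !coefX /= mulr1 mulr0 addr0.
pose a := path (- et 0%N / 3); pose c := path (et 1%N / 3).
pose B := path (et 2%N / 3); pose A := path (et 3%N / 3).
(* u = 1 + A X and v = B + X, so that u v = B + w X + A X^2 and the coefficients
   of (u v)^3 are polynomials in A, B and w. *)
pose w := 1 + A * B.
have [a0 a1] : a`_0 = 0 /\ a`_1 = - et 0%N / 3 by rewrite path0 path1.
have [c0 c1] : c`_0 = 0 /\ c`_1 = et 1%N / 3 by rewrite path0 path1.
have [B0 B1] : B`_0 = 0 /\ B`_1 = et 2%N / 3 by rewrite path0 path1.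
have [A0 A1] : A`_0 = 0 /\ A`_1 = et 3%N / 3 by rewrite path0 path1.
clearbody a c A B.
have [w0 w1] : w`_0 = 1 /\ w`_1 = 0.
  by rewrite /w !coefD coef0M coef1M !coefC /= A0 B0 !mul0r !mulr0 !addr0.
pose g k : {poly C} := nth 0 [::
  B ^+ 3 + a + c * B ^+ 6;
  3%:P * B ^+ 2 * w + 6%:P * A * a + 6%:P * B ^+ 5 * c;
  3%:P * B * w ^+ 2 + 3%:P * A * B ^+ 2 + 15%:P * A ^+ 2 * a + 15%:P * B ^+ 4 * c;
  w ^+ 3 + 6%:P * A * B * w + 20%:P * A ^+ 3 * a + 20%:P * B ^+ 3 * c;
  3%:P * A * w ^+ 2 + 3%:P * A ^+ 2 * B + 15%:P * A ^+ 4 * a + 15%:P * B ^+ 2 * c;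
  3%:P * A ^+ 2 * w + 6%:P * A ^+ 5 * a + 6%:P * B * c;
  A ^+ 3 + A ^+ 6 * a + c] k.
have gE (k : 'I_7) t : (g k).[t] = (cubes_sextic a.[t] 1 c.[t] 1 A.[t] B.[t] 1)`_k.
  have -> : cubes_sextic a.[t] 1 c.[t] 1 A.[t] B.[t] 1 = Poly [seq (g k).[t] | k <- iota 0 7].
    apply: poly_ext => x; rewrite horner_Poly /cubes_sextic /g /w /=.
    by rewrite !(hornerD, hornerN, hornerM, horner_exp, hornerC, hornerX); ring.
  by rewrite coef_Poly (nth_map 0%N) ?size_iota // nth_iota.
exists (fun k => g k); split.
- move=> M MX; apply: poly_eq0_of_nat => t; rewrite horner_along.
  rewrite -[RHS](vanishes_cubes_sextic MX a.[t%:R] 1 c.[t%:R] 1 A.[t%:R] B.[t%:R] 1).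
  by apply: meval_eq => k; rewrite gE.
- move=> k; rewrite gE !horner_coef0 a0 c0 A0 B0.
  have -> : cubes_sextic 0 1 0 1 0 0 1 = 'X^3 :> {poly C}.
    apply: poly_ext => x; rewrite /cubes_sextic.
    by rewrite !(hornerD, hornerM, horner_exp, hornerC, hornerX); ring.
  by rewrite coefXn.
- rewrite along_section_form /= !(hornerD, hornerM, horner_exp, hornerC) !horner_coef0.
  by rewrite a0 c0 A0 B0; ring.
move=> l; rewrite along_section_form.
have ett k (Hk : (k < 4)%N) : et k = eta (Ordinal Hk) by congr eta; apply: val_inj; rewrite /= inordK.
case: l => [[|[|[|[|l]]]] Hl] //=; rewrite -(ett _ Hl) /g /= ?exprS ?expr0 ?mulr1.
all: rewrite !(coefD, coefN, coef0M, coef1M, coefC) /= ?(a0, a1, c0, c1, A0, A1, B0, B1, w0, w1).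
all: by split; field.
Qed.

End Curves.

End SixteenPoints.

(** * The degree of the locus and of its closure *)

Section TriInvolutive.
Variable C : numClosedFieldType.

(** The coefficient of x^5 y tells the values of [z] apart, that of x^3 y^3 then
    those of [q], and x^3 y^3 is the only point with no term x^6. *)
Lemma special_points_separated (z : 'I_5 -> C) (q : 'I_3 -> C) :
  injective z -> (forall i, z i ^+ 5 = 1) -> injective q ->
  (forall i, q i ^+ 3 - 2 * q i ^+ 2 - 2 * q i + 1 = 0) ->
  let p (x : option ('I_5 * 'I_3)) :=
    special_point (omap (fun ij => (z ij.1, q ij.2)) x) in
  forall x y, x != y -> exists2 l : {mpoly C[7]}, l \is 1.-homog &
    l.@[fun k : 'I_7 => p y k] = 0 /\ l.@[fun k : 'I_7 => p x k] != 0.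
Proof.
move=> zI z5 qI qE p.
have z0 i : z i != 0 by apply: contraTneq (oner_neq0 C) => z0; rewrite -(z5 i) z0 expr0n eqxx.
have q0 i := q_neq0 (qE i).
have la0 i j : q j / (5 * z i ^+ 3) != 0.
  by rewrite !mulf_neq0 ?invr_eq0 ?mulf_neq0 ?pnatr_eq0 ?expf_neq0.
pose line a b k m : {mpoly C[7]} := a *: coordinate C k - b *: coordinate C m.
have line_homog a b k m : line a b k m \is 1.-homog.
  by rewrite rpredB ?rpredZ ?coordinate_homog.
have evalE a b k m x : (k < 7)%N -> (m < 7)%N ->
    (line a b k m).@[fun k : 'I_7 => p x k] = a * p x k - b * p x m.
  by move=> k7 m7; rewrite mevalB !mevalZ !mevalXU !inordK.
have p0 i j : p (Some (i, j)) 0%N = q j / (5 * z i ^+ 3).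
  by rewrite /p /= expr0 mulr1 mulr1.
have p1 i j : p (Some (i, j)) 1%N = 3 * z i * p (Some (i, j)) 0%N.
  by rewrite p0 /p /= /apolar_coef /=; ring.
have p3 i j : p (Some (i, j)) 3%N = z i ^+ 3 * (5 / q j) * p (Some (i, j)) 0%N.
  have [_ v3 _ _ _] := special_sextic_coefs (qE j).
  by rewrite p0 /p /= v3; ring.
have pn0 i j : p (Some (i, j)) 0%N != 0 by rewrite p0.
have pN k : p None k = (k == 3%N)%:R by [].
clearbody p => {p0}.
move=> [[i j]|] [[i' j']|] // xy.
- have [ii|ii] := eqVneq i i'; last first.
    exists (line 1 (3 * z i') 1%N 0%N); rewrite ?evalE // !mul1r !p1 subrr.
    split=> //; rewrite -mulrBl -mulrBr !mulf_neq0 ?pnatr_eq0 ?pn0 //.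
    by rewrite subr_eq0 (inj_eq zI).
  have jj : j != j' by apply: contraNneq xy => ->; rewrite ii.
  exists (line 1 (z i' ^+ 3 * (5 / q j')) 3%N 0%N); rewrite ?evalE // !mul1r !p3 subrr.
  split=> //; rewrite ii -mulrBl -mulrBr !mulf_neq0 ?expf_neq0 ?pn0 //.
  rewrite (_ : _ - _ = 5 * (q j' - q j) / (q j * q j')); last by field; rewrite !q0.
  by rewrite !mulf_neq0 ?invr_eq0 ?mulf_neq0 ?pnatr_eq0 // subr_eq0 (inj_eq qI) eq_sym.
- exists (line 1 0 0%N 0%N); rewrite ?evalE // !mul0r !subr0 !mul1r pN; split=> //.
- exists (line 1 (z i' ^+ 3 * (5 / q j')) 3%N 0%N); rewrite ?evalE // !mul1r p3 subrr.
  by rewrite !pN mulr0 subr0 oner_neq0.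
Qed.

Lemma hilbert_function_locus_ge k h :
  hilbert_function (@tri_involutive_locus C) (k + 15) h -> (16 * 'C(k + 4, 4) <= h)%N.
Proof.
have [z [zI z5]] := fifth_roots C; have [q [qI qE]] := cubic_roots C.
pose I : finType := option ('I_5 * 'I_3).
have cardI : #|I| = 16%N by rewrite card_option card_prod !card_ord.
have sep := special_points_separated zI z5 qI qE.
have := @hilbert_function_ge_section C 6 4 (@tri_involutive_locus C) I
  (@section_form C)
  (fun x k => special_point (omap (fun ij => (z ij.1, q ij.2)) x) k)
  (@section_form_homog C) sep.
rewrite cardI; apply.
by move=> [[i j]|] eta; [apply: curves_at_special_sextic | apply: curves_at_cube].
Qed.

Lemma hilbert_function_locus_le d h h' :
  hilbert_function (@tri_involutive_locus C) d.+1 h ->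
  hilbert_function (@tri_involutive_locus C) d h' ->
  (h + h' <= 2 * (d.+2 * 'C(d.+1 + 3, 3)) + 4 * ('C(d.+1 + 2, 2) * 'C(d.+1 + 2, 2)))%N.
Proof.
move=> hX hX'; apply: leq_trans (size_standard_bimonomials d.+1).
apply: hilbert_function_consecutive_le hX hX'; first by rewrite pnatr_eq0.
by move=> v _; apply: tri_involutive_locus_cubics.
Qed.

(** The zero locus of a form is closed. *)
Lemma vanishes_on_closure (F : fieldType) n (X : 'rV[F]_n.+1 -> Prop) (f : {mpoly F[n.+1]}) d :
  f \is d.-homog -> vanishes_on (zariski_closure X) f <-> vanishes_on X f.
Proof.
move=> fh; split=> fX v v0 vX; last first.
  case: vX => _; apply => [|u u0 Xu]; last exact: fX.
  exists (fun g => g = f); split=> [g ->|w _]; first by exists d.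
  by split=> [fw g ->|]; [|apply].
by apply: fX => //; split=> // Z _; apply.
Qed.

Lemma hilbert_function_closure (F : fieldType) n (X : 'rV[F]_n.+1 -> Prop) d h :
  hilbert_function (zariski_closure X) d h -> hilbert_function X d h.
Proof.
move=> [V [VP dimV]]; exists V; split=> // f; rewrite VP.
exact: vanishes_on_closure (valP f).
Qed.

Lemma has_degree_Omega : has_degree (@Omega C) 16.
Proof.
apply: has_degree16 => [k h /hilbert_function_closure|d h h' /hilbert_function_closure hX /hilbert_function_closure].
  exact: hilbert_function_locus_ge.
exact: hilbert_function_locus_le.
Qed.

End TriInvolutive.

Theorem proposition3p2 (R : realType) : has_degree (@Omega R[i]) 16.
Proof. exact: has_degree_Omega. Qed.
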